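(* Let $v,w,u$ be vertices of $X(\mathcal G)$ and let $p$ be a vertex on the geodesic from $v$ to $w$ with $p\ne v$ and $p\ne w$. Then $$d_{at}(u,p)\le \max\{d_{at}(u,v),d_{at}(u,w)\},\qquad d_{wd}(u,p)<\max\{d_{wd}(u,v),d_{wd}(u,w)\},$$ and moreover $$d_{wd}(u,p)\le \max\{d_{wd}(u,v),d_{wd}(u,w)\}-\min\{d_{at}(v,p),d_{at}(w,p)\}.$$
   Context: Let $S$ be a finite set and $m$ a Coxeter matrix on $S$ whose Coxeter group $\mathcal W=\langle S\mid (ss')^{m(s,s')}=1\rangle$ is finite; $\mathcal A=\langle S\mid ss's\cdots=s'ss'\cdots\ (m(s,s')\text{ letters each side})\rangle$ is the associated Artin group of finite type, $\mathcal A^+$ the submonoid generated by $S$, and $x<y$ means $y=xz$ with $z\in\mathcal A^+$. An atom is an element of $\mathcal A^+$ whose $S$-word length equals the word length of its image in $\mathcal W$; $\Delta$ is the atom mapping to the longest element of $\mathcal W$ ($\Delta^2$ is central). For $g\in\mathcal A^+$, $\alpha(g)$ is the unique atom with $\alpha(g)<g$ and $A<\alpha(g)$ for all atoms $A<g$; the normal form of $g$ is $g=A_1\cdot\ldots\cdot A_k$ with nontrivial atoms $A_i=\alpha(A_i\cdots A_k)$ (any $\Delta$'s occur first). Let $\mathcal G=\mathcal A/\langle\Delta^2\rangle$, $V=\mathcal A/\langle\Delta\rangle$ (left cosets, acted on by $\mathcal G$ on the left), $*=\langle\Delta\rangle$. Each $v\in V$ has a unique special representative in $\mathcal A^+$ whose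 normal form contains no $\Delta$; its number of atoms is the atomnorm $|v|$ and its word length is the wordnorm $\|v\|$. For $g\in\mathcal G$ with $g( * )=v$ put $d_{at}(v,w)=|g^{-1}w|$ and $d_{wd}(v,w)=\|g^{-1}w\|$ (well-defined, left-invariant; $d_{wd}$ need not be symmetric). $X(\mathcal G)$ is the simplicial complex on $V$ whose simplices are the finite sets of vertices pairwise at $d_{at}=1$. Geodesics: if the special representative of $v$ has normal form $B_1\cdot\ldots\cdot B_k$, the geodesic from $*$ to $v$ is the edge path through $*,B_1\langle\Delta\rangle,B_1B_2\langle\Delta\rangle,\dots,B_1\cdots B_k\langle\Delta\rangle=v$; the geodesic from $v$ to $w$ is the image under $g$ of the geodesic from $*$ to $g^{-1}w$, where $g( * )=v$ (this is well defined). *)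

(* Defs.v *)
From mathcomp Require Import all_boot.
From Stdlib Require Import ClassicalEpsilon.
Set Implicit Arguments. Unset Strict Implicit. Unset Printing Implicit Defensive.

Section Artin.
Variables (S : finType) (m : S -> S -> nat).

(* Coxeter matrix on S (entries finite: a finite Coxeter group forces this). *)
Definition coxeter_matrix : Prop :=
  (forall s, m s s = 1) /\ (forall s t, m s t = m t s) /\
  (forall s t, s != t -> 2 <= m s t).

Fixpoint alt (s t : S) (n : nat) : seq S :=
  if n is n'.+1 then s :: alt t s n' else [::].

(* Coxeter group W = < S | (s s')^m(s,s') = 1 >, presented as a monoid
   (the relations with s = s' make every generator an involution).       *)
Inductive cox_eq : seq S -> seq S -> Prop :=
| cox_refl x : cox_eq x x
| cox_sym x y : cox_eq x y -> cox_eq y x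
| cox_trans x y z : cox_eq x y -> cox_eq y z -> cox_eq x z
| cox_rel x y s t :
    cox_eq (x ++ flatten (nseq (m s t) [:: s; t]) ++ y) (x ++ y).

Definition coxeter_finite : Prop :=
  exists ws : seq (seq S), forall w, exists2 w', w' \in ws & cox_eq w w'.

Inductive pos_eq : seq S -> seq S -> Prop :=
| pos_refl x : pos_eq x x
| pos_sym x y : pos_eq x y -> pos_eq y x
| pos_trans x y z : pos_eq x y -> pos_eq y z -> pos_eq x z
| pos_braid x y s t :
    pos_eq (x ++ alt s t (m s t) ++ y) (x ++ alt t s (m s t) ++ y).

(* Artin group A : words in S^{+-1} ((s,true) = s, (s,false) = s^-1). *)
Definition gword := seq (S * bool).
Definition pos (w : seq S) : gword := [seq (s, true) | s <- w].
Definition ginv (g : gword) : gword := rev [seq (x.1, ~~ x.2) | x <- g].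

Inductive grp_eq : gword -> gword -> Prop :=
| grp_refl x : grp_eq x x
| grp_sym x y : grp_eq x y -> grp_eq y x
| grp_trans x y z : grp_eq x y -> grp_eq y z -> grp_eq x z
| grp_braid x y s t :
    grp_eq (x ++ pos (alt s t (m s t)) ++ y) (x ++ pos (alt t s (m s t)) ++ y)
| grp_cancel x y s b : grp_eq (x ++ [:: (s, b); (s, ~~ b)] ++ y) (x ++ y).

Definition atom (a : seq S) : Prop :=
  forall w, cox_eq a w -> size a <= size w.

(* Delta: the atom mapping to the longest element of W *)
Definition is_Delta (D : seq S) : Prop :=
  atom D /\ forall a, atom a -> size a <= size D.

Definition prec (x y : seq S) : Prop := exists z, pos_eq (x ++ z) y.

Definition is_alpha (a g : seq S) : Prop :=
  atom a /\ prec a g /\ forall b, atom b -> prec b g -> prec b a.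

Definition normal_form (r : seq S) (l : seq (seq S)) : Prop :=
  pos_eq (flatten l) r /\ all (fun A => size A != 0) l /\
  forall i, i < size l -> is_alpha (nth [::] l i) (flatten (drop i l)).

Variable D : seq S.

Definition Dpow (k : nat) : seq S := flatten (nseq k D).

(* g and h define the same vertex of X(G), i.e. g<Delta> = h<Delta> *)
Definition same_vertex (g h : gword) : Prop :=
  exists k, grp_eq (ginv g ++ h) (pos (Dpow k)) \/
            grp_eq (ginv g ++ h) (ginv (pos (Dpow k))).

Definition special_nf (g : gword) (l : seq (seq S)) : Prop :=
  exists r, same_vertex g (pos r) /\ normal_form r l /\
            forall A, A \in l -> ~ pos_eq A D.

Definition snf_of (g : gword) : seq (seq S) :=
  epsilon (inhabits [::]) (special_nf g).

(* vertices are represented by elements of A: v = gv<Delta> *)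
Definition d_at (gv gw : gword) : nat := size (snf_of (ginv gv ++ gw)).
Definition d_wd (gv gw : gword) : nat := size (flatten (snf_of (ginv gv ++ gw))).

Definition on_geodesic (gv gw gp : gword) : Prop :=
  exists l, special_nf (ginv gv ++ gw) l /\
    exists2 i, i <= size l & same_vertex gp (gv ++ pos (flatten (take i l))).

End Artin.

(* Main.v *)
(** Each element of the Coxeter group [W] is represented by a unique atom
    (Matsumoto's theorem), so the positive monoid is modelled by greedy lists of
    elements of [W], on which an atom acts by left multiplication; the first entry
    of a product [g l] depends only on [g] and on the first entry of [l].  Deleting
    the [Delta]s, which commute with everything up to conjugation, turns this into
    an action of the Artin group on the vertices.

    Move [u] to the base point, let [y] be the special representative of [v] and
    [B_1 ... B_k] the geodesic from [v] to [w].  While each step of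
    [y B_1 ... B_i] acquires a new [Delta], the atomnorm does not increase and the
    wordnorm drops by [len Delta - len B_i >= 1].  Once a step acquires no [Delta],
    no later one does; from then on the atomnorm does not decrease and the wordnorm
    grows by [len B_i >= 1].  So both norms are valley-shaped along the geodesic. *)
From HB Require Import structures.
From mathcomp Require Import all_boot all_algebra all_field.
From mathcomp Require Import ring zify.
From Stdlib Require Import ClassicalEpsilon.
Require Import Defs.
Set Implicit Arguments. Unset Strict Implicit. Unset Printing Implicit Defensive.

(** * The order of a product of two generators *)

Section GeometricRepresentation.
Import GRing.Theory.
Local Open Scope ring_scope.
Variables (S : finType) (m : S -> S -> nat).
Hypothesis Hm : coxeter_matrix m.

Lemma cox_mxx s : m s s = 1%N. Proof. by case: Hm. Qed.
Lemma cox_mxC s t : m s t = m t s. Proof. by case: Hm => _ []. Qed.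
Lemma cox_mx_ge2 s t : s != t -> (1 < m s t)%N.
Proof. by case: Hm => _ [_]; apply. Qed.
Lemma cox_mx_gt0 s t : (0 < m s t)%N.
Proof. by case: (eqVneq s t) => [->|/cox_mx_ge2/ltnW//]; rewrite cox_mxx. Qed.

Definition unity_root (n : nat) : algC := sval (C_prim_root_exists (ltn0Sn n.-1)).

Lemma unity_rootP n : (0 < n)%N -> n.-primitive_root (unity_root n).
Proof. by rewrite /unity_root; case: n => // n _; case: C_prim_root_exists. Qed.

(** Any primitive root of order [2 * m s t] can stand for exp (i pi / m): what matters is that its
    square has order exactly [m s t]. *)
Definition zeta s t := unity_root (m s t).*2.

Lemma zeta_prim s t : ((m s t).*2).-primitive_root (zeta s t).
Proof. by apply: unity_rootP; rewrite double_gt0 cox_mx_gt0. Qed.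

Lemma zetaC s t : zeta s t = zeta t s.
Proof. by rewrite /zeta cox_mxC. Qed.

Lemma zeta_neq0 s t : zeta s t != 0.
Proof.
have := prim_expr_order (zeta_prim s t).
by apply: contra_eq_neq => ->; rewrite expr0n double_eq0 eqn0Ngt cox_mx_gt0 eq_sym oner_eq0.
Qed.

Lemma zeta2_order s t k : ((zeta s t ^+ 2) ^+ k == 1) = (m s t %| k)%N.
Proof.
rewrite -exprM -(prim_order_dvd (zeta_prim s t)) -mul2n dvdn_pmul2l //.
Qed.

(* [cartan s t] is minus the usual Cartan coefficient: [-2] on the diagonal,
   [2 cos (pi / m s t)] off it. *)
Definition cartan s t : algC :=
  if s == t then -2 else zeta s t + (zeta s t)^-1.

(** A function [f] records the values of a linear form on the simple roots; [refl_act s] composes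
    the form with the reflection in the root of [s]. *)
Definition refl_act s (f : {ffun S -> algC}) : {ffun S -> algC} :=
  [ffun u => f u + cartan s u * f s].

Lemma refl_actK s : involutive (refl_act s).
Proof.
by move=> f; apply/ffunP => u; rewrite !ffunE /cartan eqxx; ring.
Qed.

Definition word_act (x : seq S) f := foldr refl_act f x.

Lemma word_act_cat x y f : word_act (x ++ y) f = word_act x (word_act y f).
Proof. exact: foldr_cat. Qed.

Section Dihedral.
Variables s t : S.
Hypothesis neq_st : s != t.
Let z := zeta s t.
Let R f := refl_act s (refl_act t f).

(* Eigenfunctionals of the rotation [R], for the eigenvalues [z^2] and [z^-2]. *)
Let lam (b : bool) (f : {ffun S -> algC}) := f s + (if b then z else z^-1) * f t.

Let lamR b f : lam b (R f) = (if b then z ^+ 2 else z ^- 2) * lam b f.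
Proof.
(* [x'] and [y'] are the values at [s] and [t] after the reflection in [t]; the left-hand sides then
   apply the reflection in [s]. *)
have key (F : fieldType) (w x y : F) (w0 : w != 0) :
  let y' := - y in let x' := x + (w + w^-1) * y in
  - x' + w * (y' + (w + w^-1) * x') = w ^+ 2 * (x + w * y) /\
  - x' + w^-1 * (y' + (w + w^-1) * x') = w ^- 2 * (x + w^-1 * y).
  by split; field.
have [keyT keyF] := key _ z (f s) (f t) (zeta_neq0 s t).
rewrite /lam /R /refl_act !ffunE /cartan !eqxx (eq_sym t s) (negbTE neq_st).
rewrite (zetaC t s) -/z.
have e (u : algC) : u + -2 * u = - u by ring.
by rewrite !e; case: b; rewrite ?keyT ?keyF.
Qed.

Let lam_iter b k f :
  lam b (iter k R f) = (if b then z ^+ 2 else z ^- 2) ^+ k * lam b f.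
Proof.
elim: k => [|k IH]; first by rewrite expr0 mul1r.
by rewrite iterS lamR IH mulrA -exprS.
Qed.

Let z2_neq1 : z ^+ 2 != 1.
Proof.
by rewrite -[z ^+ 2]expr1 zeta2_order dvdn1 neq_ltn (cox_mx_ge2 neq_st) orbT.
Qed.

(** [R f - f] involves only [f s] and [f t], and these are combinations of the two eigenfunctionals,
    which are independent because [z ^+ 2 != 1]. *)
Let R_lam u : exists a b, forall f, R f u = f u + a * lam true f + b * lam false f.
Proof.
have key (F : fieldType) (w p q v x y : F) : w != 0 -> w ^+ 2 - 1 != 0 ->
  let c := w / (w ^+ 2 - 1) in
  v + p * y + q * x = v + (p * c - q * c / w) * (x + w * y)
                        + (q * c * w - p * c) * (x + w^-1 * y).
  by move=> w0 w1 c; rewrite /c; field; rewrite w0 w1.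
have z1 : z ^+ 2 - 1 != 0 by rewrite subr_eq0 z2_neq1.
pose q := cartan s u; pose p := cartan t u + q * cartan t s.
pose c := z / (z ^+ 2 - 1).
exists (p * c - q * c / z), (q * c * z - p * c) => f.
have {key} := key _ z p q (f u) (f s) (f t) (zeta_neq0 s t) z1.
rewrite /lam -/c => <-.
by rewrite /R /refl_act !ffunE /p /q; ring.
Qed.

(** The indicator of [s] has [lam true] equal to 1, so its return after [k] rotations forces
    [(z ^+ 2) ^+ k = 1]. *)
Lemma rotation_id k : iter k R =1 id -> (m s t %| k)%N.
Proof.
move=> Rk; pose f : {ffun S -> algC} := [ffun u => (u == s)%:R].
have := lam_iter true k f; rewrite Rk /lam !ffunE eqxx eq_sym (negbTE neq_st).
by rewrite mulr0 addr0 mulr1 => /esym/eqP; rewrite zeta2_order.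
Qed.

(** By [R_lam], the total change at [u] is a combination of geometric sums of ratios [z ^+ 2] and
    [z ^- 2], which vanish over [m s t] terms. *)
Lemma rotation_order : iter (m s t) R =1 id.
Proof.
move=> f; apply/ffunP => u; have [a [b Ru]] := R_lam u.
have H k : iter k R f u = f u + a * (\sum_(i < k) (z ^+ 2) ^+ i) * lam true f
                          + b * (\sum_(i < k) (z ^- 2) ^+ i) * lam false f.
  elim: k => [|k IH]; first by rewrite !big_ord0 !mulr0 !mul0r !addr0.
  by rewrite iterS Ru IH !lam_iter !big_ord_recr /=; ring.
have sum0 w : w != 1 -> w ^+ m s t = 1 -> \sum_(i < m s t) w ^+ i = 0 :> algC.
  move=> w1 wm; apply/eqP; rewrite -(mulrI_eq0 _ (mulfI (_ : w - 1 != 0))) ?subr_eq0 //.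
  by rewrite -subrX1 wm subrr.
have zm : (z ^+ 2) ^+ m s t = 1 by apply/eqP; rewrite zeta2_order.
by rewrite H !sum0 ?invr_eq1 ?z2_neq1 ?exprVn ?zm ?invr1 // !mulr0 !mul0r !addr0.
Qed.
End Dihedral.

Lemma word_act_nseq k s t f :
  word_act (flatten (nseq k [:: s; t])) f = iter k (fun f => refl_act s (refl_act t f)) f.
Proof. by elim: k => //= k ->. Qed.

Lemma word_act_cox x y : cox_eq m x y -> word_act x =1 word_act y.
Proof.
elim=> // [{}x {}y _ IH f|{}x {}y w _ IH1 _ IH2 f|{}x {}y s t f].
- by rewrite IH.
- by rewrite IH1.
rewrite !word_act_cat word_act_nseq; congr word_act.
have [<-|st] := eqVneq s t; last exact: rotation_order.
by rewrite cox_mxx /= refl_actK.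
Qed.

Lemma cox_eq_rotation s t k :
  s != t -> cox_eq m (flatten (nseq k [:: s; t])) [::] -> (m s t %| k)%N.
Proof.
by move=> st /word_act_cox H; apply: rotation_id => // f; rewrite -word_act_nseq H.
Qed.

End GeometricRepresentation.

(** * The Coxeter group *)

Section CoxeterQuotient.
Local Open Scope quotient_scope.
Variables (S : finType) (m : S -> S -> nat).

(** The word problem is decided classically, which lets the congruence define a quotient type. *)
Definition cox_eqb (x y : seq S) : bool :=
  if excluded_middle_informative (cox_eq m x y) then true else false.

Lemma cox_eqP x y : reflect (cox_eq m x y) (cox_eqb x y).
Proof.
by rewrite /cox_eqb; case: excluded_middle_informative => h; constructor.
Qed.

Lemma cox_eqb_equiv : equiv_class_of cox_eqb.
Proof.
split=> [x|x y|y x z].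
- by apply/cox_eqP; apply: cox_refl.
- by apply/cox_eqP/cox_eqP; apply: cox_sym.
- by move=> /cox_eqP xy /cox_eqP yz; apply/cox_eqP/(cox_trans xy yz).
Qed.
Canonical cox_equiv_rel := EquivRelPack cox_eqb_equiv.

Lemma cox_eq_cat x x' y y' :
  cox_eq m x x' -> cox_eq m y y' -> cox_eq m (x ++ y) (x' ++ y').
Proof.
move=> xx' yy'; apply: (@cox_trans _ _ _ (x' ++ y)).
  elim: xx' => [z|z t _ h|z t u _ h _ k|z t a b].
  - exact: cox_refl.
  - exact: cox_sym.
  - exact: cox_trans h k.
  - rewrite -!catA; exact: cox_rel.
elim: yy' => [z|z t _ h|z t u _ h _ k|z t a b].
- exact: cox_refl.
- exact: cox_sym.
- exact: cox_trans h k.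
- rewrite !(catA x' z); exact: cox_rel.
Qed.

Hypothesis Hm : coxeter_matrix m.

Lemma cox_eq_revK x : cox_eq m (rev x ++ x) [::].
Proof.
elim: x => [|s x IH]; first exact: cox_refl.
rewrite rev_cons cat_rcons; apply: cox_trans IH.
have := cox_rel m (rev x) x s s; rewrite (cox_mxx Hm) //=.
Qed.

Lemma cox_eq_rev x y : cox_eq m x y -> cox_eq m (rev x) (rev y).
Proof.
move=> xy; have := cox_eq_cat (cox_refl m (rev x)) (cox_sym (cox_eq_revK (rev y))).
rewrite cats0 revK => /cox_trans; apply; rewrite catA.
have h := cox_trans (cox_eq_cat (cox_refl m (rev x)) (cox_sym xy)) (cox_eq_revK x).
exact: cox_eq_cat h (cox_refl _ _).
Qed.

(** The type carries the Coxeter hypothesis because the group structure needs it: inversion is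
    reversal of words, which relies on [m s s = 1]. *)
Definition coxgroup of coxeter_matrix m := {eq_quot cox_eqb}.
End CoxeterQuotient.

HB.instance Definition _ S m (Hm : @coxeter_matrix S m) :=
  Choice.on (coxgroup Hm).

Section CoxeterGroup.
Variables (S : finType) (m : S -> S -> nat) (Hm : coxeter_matrix m).
Local Open Scope quotient_scope.
Local Notation W := (coxgroup Hm).

Definition ev (x : seq S) : W := \pi_({eq_quot (cox_eqb m)}) x.
Definition word_of (w : W) : seq S := repr (w : {eq_quot (cox_eqb m)}).

Lemma word_ofK : cancel word_of ev. Proof. by move=> w; rewrite /ev reprK. Qed.

Lemma evP x y : ev x = ev y <-> cox_eq m x y.
Proof. by split=> [/eqmodP/cox_eqP //|/cox_eqP h]; apply/eqmodP. Qed.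

Let mulw (v w : W) : W := ev (word_of v ++ word_of w).
Let invw (w : W) : W := ev (rev (word_of w)).
Let onew : W := ev [::].

Let ev_mul x y : mulw (ev x) (ev y) = ev (x ++ y).
Proof. by apply/evP; apply: cox_eq_cat; apply/evP/word_ofK. Qed.

Let ev_inv x : invw (ev x) = ev (rev x).
Proof. by apply/evP/(cox_eq_rev Hm)/evP/word_ofK. Qed.

Let mulwA : associative mulw.
Proof.
by move=> u v w; rewrite -(word_ofK u) -(word_ofK v) -(word_ofK w) !ev_mul catA.
Qed.
Let mul1w : left_id onew mulw.
Proof. by move=> w; rewrite -(word_ofK w) ev_mul. Qed.
Let mulw1 : right_id onew mulw.
Proof. by move=> w; rewrite -(word_ofK w) ev_mul cats0. Qed.
Let mulVw : left_inverse onew invw mulw.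
Proof. by move=> w; rewrite -(word_ofK w) ev_inv ev_mul; apply/evP/cox_eq_revK. Qed.
Let mulwV : right_inverse onew invw mulw.
Proof.
move=> w; rewrite -(word_ofK w) ev_inv ev_mul; apply/evP.
by rewrite -{1}(revK (word_of w)); apply: cox_eq_revK.
Qed.

HB.instance Definition _ := isGroup.Build W mulwA mul1w mulw1 mulVw mulwV.

Local Open Scope group_scope.

Lemma ev_cat x y : ev (x ++ y) = ev x * ev y. Proof. exact: esym (ev_mul x y). Qed.
Lemma ev_nil : ev [::] = 1. Proof. by []. Qed.
Lemma ev_rev x : ev (rev x) = (ev x)^-1. Proof. exact: esym (ev_inv x). Qed.

End CoxeterGroup.

(** * Word length in the Coxeter group *)

Section Length.
Variables (S : finType) (m : S -> S -> nat) (Hm : coxeter_matrix m).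
Local Open Scope group_scope.
Local Notation W := (coxgroup Hm).
Local Notation ev := (ev Hm).
Implicit Types (v w : W) (x y : seq S) (s t : S).

Definition gen s : W := ev [:: s].

Lemma ev_cons s x : ev (s :: x) = gen s * ev x.
Proof. by rewrite -cat1s ev_cat. Qed.

Lemma gen_sqr s : gen s * gen s = 1.
Proof.
rewrite /gen -ev_cat; apply/evP.
by have := cox_rel m [::] [::] s s; rewrite (cox_mxx Hm).
Qed.

Lemma genV s : (gen s)^-1 = gen s.
Proof. by apply: mulg1_eq; apply: gen_sqr. Qed.

Lemma genK s w : gen s * (gen s * w) = w.
Proof. by rewrite mulgA gen_sqr mul1g. Qed.

Lemma ev_nseq k s t : ev (flatten (nseq k [:: s; t])) = (gen s * gen t) ^+ k.
Proof. by elim: k => //= k IH; rewrite !ev_cons IH mulgA -expgS. Qed.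

Lemma gen_order s t : (gen s * gen t) ^+ m s t = 1.
Proof.
rewrite -ev_nseq; apply/evP.
by have := cox_rel m [::] [::] s t; rewrite !cats0.
Qed.

Lemma odd_size_ev x y : ev x = ev y -> odd (size x) = odd (size y).
Proof.
move/evP; elim=> // [{}x {}y z _ -> _ -> //|{}x {}y s t].
rewrite !size_cat !oddD; congr (_ (+) _); rewrite -[RHS]addFb; congr (_ (+) _).
by elim: (m s t) => //= k ->.
Qed.

Let word_exists w : exists n, [exists x : n.-tuple S, ev x == w].
Proof.
exists (size (word_of w)); apply/existsP; exists (in_tuple (word_of w)).
by rewrite word_ofK.
Qed.

Definition len w : nat := ex_minn (word_exists w).

Lemma len_ev x : len (ev x) <= size x.
Proof.
rewrite /len; case: ex_minnP => n _; apply.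
by apply/existsP; exists (in_tuple x).
Qed.

Let reduced_word_exists w : exists x, (ev x == w) && (size x == len w).
Proof.
rewrite /len; case: ex_minnP => n /existsP[x xw] _; exists (val x).
by rewrite xw size_tuple eqxx.
Qed.

Definition rword w : seq S := xchoose (reduced_word_exists w).

Lemma rwordK : cancel rword ev.
Proof. by move=> w; have /andP[/eqP] := xchooseP (reduced_word_exists w). Qed.

Lemma size_rword w : size (rword w) = len w.
Proof. by have /andP[_ /eqP] := xchooseP (reduced_word_exists w). Qed.

Definition reduced x := size x == len (ev x).

Lemma reduced_rword w : reduced (rword w).
Proof. by rewrite /reduced rwordK size_rword. Qed.

Lemma atomP x : reflect (atom m x) (reduced x).
Proof.
apply: (iffP eqP) => [e w /evP xw|h].
  by rewrite e (_ : ev x = ev w) ?len_ev //; apply/evP/evP.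
apply/eqP; rewrite eqn_leq len_ev andbT -size_rword; apply: h.
by apply/(evP Hm); rewrite rwordK.
Qed.

Lemma odd_len_ev x : odd (len (ev x)) = odd (size x).
Proof. by rewrite -size_rword; apply: odd_size_ev; rewrite rwordK. Qed.

Lemma len1 : len 1 = 0.
Proof. by apply/eqP; rewrite -leqn0 -(ev_nil Hm) len_ev. Qed.

Lemma len_eq0 w : (len w == 0) = (w == 1).
Proof.
apply/eqP/eqP => [|->]; last exact: len1.
by rewrite -size_rword => /size0nil e; rewrite -(rwordK w) e.
Qed.

Lemma lenM v w : len (v * w) <= len v + len w.
Proof.
rewrite -{1}(rwordK v) -{1}(rwordK w) -ev_cat -(size_rword v) -(size_rword w).
by rewrite -size_cat len_ev.
Qed.

Lemma lenV w : len w^-1 = len w.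
Proof.
suff h v : len v^-1 <= len v.
  by apply/eqP; rewrite eqn_leq h /= -{1}(invgK w) h.
by rewrite -{1}(rwordK v) -ev_rev (leq_trans (len_ev _)) // size_rev size_rword.
Qed.

Lemma odd_lenM v w : odd (len (v * w)) = odd (len v) (+) odd (len w).
Proof.
by rewrite -{1}(rwordK v) -{1}(rwordK w) -ev_cat odd_len_ev size_cat oddD !size_rword.
Qed.

Lemma len_gen s : len (gen s) = 1%N.
Proof.
have : odd (len (gen s)) by rewrite odd_len_ev.
by have := len_ev [:: s]; rewrite /= -/(gen s); case: (len _) => [|[]].
Qed.

(** The two lengths differ by at most one, and parity excludes equality. *)
Lemma len_genM s w : len (gen s * w) = (len w).+1 \/ len w = (len (gen s * w)).+1.
Proof.
have h1 := lenM (gen s) w; have h2 := lenM (gen s) (gen s * w).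
have := odd_lenM (gen s) w; rewrite genK len_gen in h1 h2 *.
move: h1 h2; rewrite !add1n leq_eqVlt => /predU1P[-> _ _|]; first by left.
rewrite ltnS leq_eqVlt => /predU1P[-> _|]; first by case: odd.
by move=> lt1 le2 _; right; apply/eqP; rewrite eqn_leq le2.
Qed.

Lemma len_genM_lt s w : len (gen s * w) < len w -> len w = (len (gen s * w)).+1.
Proof. by case: (len_genM s w) => // ->; rewrite ltnNge leqW. Qed.

Lemma reduced_cat x y : reduced (x ++ y) -> reduced x /\ reduced y.
Proof.
rewrite /reduced ev_cat size_cat => /eqP e.
have h := lenM (ev x) (ev y); rewrite -e in h.
have hx := len_ev x; have hy := len_ev y.
split; rewrite eqn_leq ?hx ?hy andbT.
  by rewrite -(leq_add2r (size y)) (leq_trans h) // leq_add2l.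
by rewrite -(leq_add2l (size x)) (leq_trans h) // leq_add2r.
Qed.

(** * The reflection cocycle and the exchange condition *)

Fixpoint refls x : seq W :=
  if x is s :: x' then gen s :: [seq gen s * r * gen s | r <- refls x'] else [::].

Lemma refls_cat x y :
  refls (x ++ y) = refls x ++ [seq ev x * r * (ev x)^-1 | r <- refls y].
Proof.
elim: x => [|s x IH] /=.
  by rewrite ev_nil -[LHS]map_id; apply: eq_map => r; rewrite mul1g invg1 mulg1.
rewrite IH map_cat -map_comp; congr (_ :: _ ++ _); apply: eq_map => r /=.
by rewrite ev_cons invgM genV !mulgA.
Qed.

(** For [x = s_1 ... s_n], [refls x] lists the reflections [s_1 ... s_i ... s_1]. How often [t]
    occurs depends on the word, but the parity depends only on [ev x]. *)
Definition refl_parity x (t : W) := odd (count_mem t (refls x)).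

Lemma refl_parity_cat x y (t : W) :
  refl_parity (x ++ y) t = refl_parity x t (+) refl_parity y (t ^ ev x).
Proof.
rewrite /refl_parity refls_cat count_cat oddD count_map; congr (_ (+) odd _).
apply: eq_count => r /=; rewrite conjgE; apply/eqP/eqP => [<-|->].
  by rewrite !mulgA mulVg mul1g mulgVK.
by rewrite !mulgA mulgV mul1g mulgK.
Qed.

Lemma refls_nseq k s t :
  refls (flatten (nseq k [:: s; t]))
  = [seq (gen s * gen t) ^+ i * gen s | i <- iota 0 k.*2].
Proof.
elim: k => // k IH; rewrite doubleS /= expg0 mul1g expg1; congr [:: _, _ & _].
rewrite IH -(addn0 2) iotaDl -!map_comp; apply: eq_map => i /=.
rewrite add2n expgSr expgS; set c := _ ^+ i.
by rewrite !mulgA.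
Qed.

(** The powers of [gen s * gen t] repeat after [m s t] terms, so the reflections of a relator form
    one list traversed twice. *)
Lemma refl_parity_rel s t r : refl_parity (flatten (nseq (m s t) [:: s; t])) r = false.
Proof.
rewrite /refl_parity refls_nseq -addnn iotaD map_cat count_cat add0n.
have -> : iota (m s t) (m s t) = [seq m s t + i | i <- iota 0 (m s t)].
  by rewrite -iotaDl addn0.
rewrite -map_comp (eq_map (g := fun i => (gen s * gen t) ^+ i * gen s)).
  by rewrite addnn odd_double.
by move=> i /=; rewrite expgnDr gen_order mul1g.
Qed.

Lemma refl_parity_ev x y : ev x = ev y -> refl_parity x =1 refl_parity y.
Proof.
move/evP; elim=> // [{}x {}y _ IH t|{}x {}y z _ IH1 _ IH2 t|{}x {}y s t r].
- by rewrite IH.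
- by rewrite IH1.
rewrite !refl_parity_cat refl_parity_rel addFb ev_nseq gen_order.
by rewrite conjg1.
Qed.

Lemma mem_refls x (t : W) : t \in refls x ->
  exists x1 r x2, x = x1 ++ r :: x2 /\ t * ev x1 = ev (x1 ++ [:: r]).
Proof.
elim: x t => //= s x IH t; rewrite inE => /predU1P[->|/mapP[r /IH]].
  by exists [::], s, x; rewrite ev_nil mulg1.
case=> x1 [a [x2 [-> e]]] ->; exists (s :: x1), a, x2; split=> //.
by rewrite !ev_cons -e -!mulgA genK.
Qed.

(** An odd count puts [t] in the list, and multiplying by a listed reflection deletes one letter of
    the word. *)
Lemma refl_parity_shorter x (t : W) : refl_parity x t -> len (t * ev x) < size x.
Proof.
move=> h; have /mem_refls[x1 [r [x2 [-> e]]]] : t \in refls x.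
  by rewrite -has_pred1 has_count; move: h; rewrite /refl_parity; case: count.
rewrite -cat_rcons -cats1 ev_cat mulgA.
have -> : t * ev (x1 ++ [:: r]) = ev x1.
  by rewrite ev_cat mulgA e ev_cat -mulgA gen_sqr mulg1.
by rewrite -ev_cat (leq_ltn_trans (len_ev _)) // !size_cat /= addn1 addSn.
Qed.

(** Replace [x] by [s :: y] with [y] a reduced word of [gen s * ev x]. The first letter contributes
    one occurrence of [gen s]; an odd number of others would make [ev x] shorter than
    [gen s * ev x]. *)
Lemma refl_parity_gen s x : len (gen s * ev x) < len (ev x) -> refl_parity x (gen s).
Proof.
move=> lt; pose y := rword (gen s * ev x).
have -> : refl_parity x (gen s) = refl_parity (s :: y) (gen s).
  by apply: refl_parity_ev; rewrite ev_cons rwordK genK.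
rewrite -cat1s refl_parity_cat {1}/refl_parity /= eqxx /=.
rewrite conjgE -/(gen s) gen_sqr mulg1 genV; apply/negP => /refl_parity_shorter.
by rewrite /y rwordK genK size_rword ltnNge ltnW.
Qed.

Lemma exchange s x : len (gen s * ev x) < len (ev x) ->
  exists x1 r x2, x = x1 ++ r :: x2 /\ gen s * ev x1 = ev (x1 ++ [:: r]).
Proof.
move/refl_parity_gen => h; apply: mem_refls.
by rewrite -has_pred1 has_count; move: h; rewrite /refl_parity; case: count.
Qed.

End Length.

(** * The weak order *)

Section WeakOrder.
Variables (S : finType) (m : S -> S -> nat) (Hm : coxeter_matrix m).
Local Open Scope group_scope.
Local Notation W := (coxgroup Hm).
Local Notation ev := (ev Hm).
Local Notation gen := (gen Hm).
Local Notation reduced := (reduced Hm).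
Implicit Types (u v w : W) (x y : seq S) (s t : S).

Lemma size_alt s t k : size (alt s t k) = k.
Proof. by elim: k s t => //= k IH s t; rewrite IH. Qed.

Lemma take_alt i s t k : i <= k -> take i (alt s t k) = alt s t i.
Proof. by elim: i k s t => [|i IH] [|k] //= s t ik; rewrite IH. Qed.

Lemma ev_alt_rot s t k : ev (alt s t k) = (gen s * gen t) ^+ k * ev (alt t s k).
Proof.
elim: k s t => [|k IH] s t; first by rewrite mul1g.
have swap j : gen s * (gen t * gen s) ^+ j = (gen s * gen t) ^+ j * gen s.
  elim: j => [|j IHj]; first by rewrite mulg1 mul1g.
  by rewrite !expgSr mulgA IHj !mulgA.
by rewrite /= !ev_cons (IH t s) expgSr mulgA swap -!mulgA genK.
Qed.

Lemma ev_alt_eq s t k : s != t -> ev (alt s t k) = ev (alt t s k) -> m s t %| k.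
Proof.
move=> st; rewrite ev_alt_rot -[RHS]mul1g => /mulIg e.
by apply: cox_eq_rotation st _ => //; apply/(evP Hm); rewrite ev_nseq e.
Qed.

Lemma ev_alt_braid s t : ev (alt s t (m s t)) = ev (alt t s (m s t)).
Proof. by rewrite ev_alt_rot gen_order mul1g. Qed.

(** Induction on [k], with [s] and [t] exchanged. The letter deleted by the exchange condition for
    [s] cannot lie in the alternating prefix: that would equate the two alternating words of some
    positive length below [m s t]. So it lies in the remainder, and [s] can be put in front. *)
Lemma alt_prefix s t w k : s != t ->
    len (gen s * w) < len w -> len (gen t * w) < len w -> k <= m s t ->
  exists y, w = ev (alt s t k ++ y) /\ k + size y = len w.
Proof.
elim: k s t => [|k IH] s t st sw tw km.
  by exists (rword w); rewrite rwordK size_rword.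
have [||y [ey sy]] := IH t s _ tw sw; rewrite 1?eq_sym ?(cox_mxC Hm t s) 1?ltnW //.
have e : len (ev (alt t s k ++ y)) = k + size y by rewrite -ey.
have [|x1 [r [x2 [ex es]]]] := @exchange _ _ Hm s (alt t s k ++ y); first by rewrite -ey.
have [lt_x1|le_x1] := ltnP (size x1) k.
  have take_x j : j <= k -> take j (x1 ++ r :: x2) = alt t s j.
    by move=> jk; rewrite -ex takel_cat ?size_alt // take_alt.
  move: (take_x _ (ltnW lt_x1)) (take_x _ lt_x1).
  rewrite take_size_cat // -cat_rcons take_size_cat ?size_rcons // => a1 a2.
  move: es; rewrite cats1 a2 a1 -ev_cons size_alt => e1.
  have := @dvdn_leq _ (size x1).+1 isT (ev_alt_eq (k := (size x1).+1) st e1).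
  by rewrite leqNgt (leq_ltn_trans lt_x1 km).
have e1 : x1 = alt t s k ++ drop k x1.
  have := congr1 (take k) ex; rewrite take_size_cat ?size_alt // takel_cat //.
  by move=> ->; rewrite cat_take_drop.
exists (drop k x1 ++ x2); split.
  rewrite /= ev_cons catA -e1 ev_cat mulgA es ey ex -cat_rcons -cats1 !ev_cat.
  by [].
have := congr1 size ex; rewrite !size_cat size_alt /= {1}e1 size_cat size_alt.
by rewrite sy => ->; rewrite addnS addSn addnA.
Qed.

(* [adds v w]: the atoms of [v] and [w] multiply to an atom.  The weak order [pre]
   is then divisibility of atoms. *)
Definition adds v w := len (v * w) == len v + len w.

Lemma addsP v w : reflect (len (v * w) = len v + len w) (adds v w).
Proof. exact: eqP. Qed.

Lemma adds1w w : adds 1 w. Proof. by rewrite /adds mul1g len1. Qed.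
Lemma addsw1 w : adds w 1. Proof. by rewrite /adds mulg1 len1 addn0. Qed.

(** Both sides say that the length of [u * v * w] is the sum of the three lengths. *)
Lemma addsA u v w : adds u v && adds (u * v) w = adds v w && adds u (v * w).
Proof.
have e : len (u * (v * w)) = len (u * v * w) by rewrite mulgA.
have h1 := lenM u v; have h2 := lenM v w.
have h3 := lenM (u * v) w; have h4 := lenM u (v * w); rewrite /adds.
by apply/andP/andP => -[/eqP e1 /eqP e2]; split; apply/eqP; lia.
Qed.

Definition pre v w := adds v (v^-1 * w).

Lemma adds_pre v w : adds v w -> pre v (v * w).
Proof. by rewrite /pre mulKg. Qed.

Lemma preP v w : reflect (exists2 u, adds v u & w = v * u) (pre v w).
Proof.
apply: (iffP idP) => [h|[u h ->]]; last exact: adds_pre.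
by exists (v^-1 * w); rewrite ?mulVKg.
Qed.

Lemma pre_refl w : pre w w. Proof. by rewrite /pre mulVg addsw1. Qed.
Lemma pre1w w : pre 1 w. Proof. by rewrite /pre invg1 mul1g adds1w. Qed.

Lemma pre_len v w : pre v w -> len v <= len w.
Proof. by case/preP=> u /addsP h ->; rewrite h leq_addr. Qed.

Lemma pre_len_eq v w : pre v w -> len w <= len v -> v = w.
Proof.
case/preP=> u /addsP h ->; rewrite h -[X in _ <= X]addn0 leq_add2l leqn0 len_eq0.
by move/eqP->; rewrite mulg1.
Qed.

Lemma pre_anti v w : pre v w -> pre w v -> v = w.
Proof. by move=> h /pre_len; apply: pre_len_eq. Qed.

Lemma pre_w1 w : pre w 1 -> w = 1.
Proof. by move=> h; apply: pre_anti h (pre1w _). Qed.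

Lemma pre_trans : transitive pre.
Proof.
move=> v u w /preP[a ua ->] /preP[b uab ->]; rewrite -mulgA; apply: adds_pre.
by have := addsA u a b; rewrite ua uab => /esym/andP[].
Qed.

Lemma adds_preW u v w : adds u w -> pre v w -> adds u v.
Proof.
move=> uw /preP[a va e]; rewrite e in uw.
by have := addsA u v a; rewrite va uw => /andP[].
Qed.

Lemma pre_mul2l u v w : adds u w -> pre v w -> pre (u * v) (u * w).
Proof.
move=> uw /preP[a va e]; rewrite e in uw *; rewrite mulgA; apply: adds_pre.
by have := addsA u v a; rewrite va uw => /andP[].
Qed.

Lemma pre_mulI u v w : adds u v -> pre (u * v) (u * w) -> pre v w.
Proof.
move=> uv; rewrite /pre invgM -mulgA mulKg => uvw.
by have := addsA u v (v^-1 * w); rewrite uv uvw => /esym/andP[].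
Qed.

Lemma pre_gen s w : pre (gen s) w = (len (gen s * w) < len w).
Proof.
rewrite /pre /adds genV genK len_gen add1n; apply/eqP/idP => [->//|].
exact: len_genM_lt.
Qed.

Lemma descent w : w != 1 -> exists s, pre (gen s) w.
Proof.
rewrite -len_eq0 -size_rword => h.
have := rwordK w; have := reduced_rword w; case: (rword w) h => //= s x _.
rewrite /reduced ev_cons => /eqP e <-; exists s; rewrite pre_gen genK -e /=.
by rewrite ltnS len_ev.
Qed.

Lemma reduced_cons s x : reduced (s :: x) -> adds (gen s) (ev x) /\ reduced x.
Proof.
move=> h; have [_ hx] := reduced_cat (x := [:: s]) h; split=> //.
by rewrite /adds -ev_cons -(eqP h) -(eqP hx) len_gen.
Qed.

Lemma reduced_rword_cat v w : adds v w -> reduced (rword v ++ rword w).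
Proof. by rewrite /reduced ev_cat !rwordK size_cat !size_rword eq_sym. Qed.

(** If adding [s] shortened a reduced alternating word of length [k], both [s] and [t] would be
    descents of it, and [alt_prefix] would give it a prefix of length [k.+1]. *)
Lemma reduced_alt s t k : s != t -> k <= m s t -> reduced (alt s t k).
Proof.
elim: k s t => [|k IH] s t st km; first by rewrite /reduced /= ev_nil len1.
have rk : reduced (alt t s k).
  by rewrite IH 1?eq_sym // (cox_mxC Hm) ltnW.
have [|e] := len_genM s (ev (alt t s k)).
  by rewrite /reduced ev_cons => ->; rewrite -(eqP rk) !size_alt.
have tk : len (gen t * ev (alt t s k)) < len (ev (alt t s k)).
  case: k {IH km} rk e => [|k] rk e; first by move: e; rewrite len1.
  by rewrite ev_cons genK -ev_cons -(eqP rk) /= ltnS len_ev.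
have [|y [_]] := alt_prefix st _ tk km; first by rewrite e.
by rewrite -(eqP rk) size_alt; lia.
Qed.

Lemma pre_alt s t w : s != t -> pre (gen s) w -> pre (gen t) w ->
  pre (ev (alt s t (m s t))) w.
Proof.
rewrite !pre_gen => st sw tw; have [y [-> e]] := alt_prefix st sw tw (leqnn _).
rewrite ev_cat; apply: adds_pre; apply/addsP.
have := reduced_alt st (leqnn _); have := len_ev Hm y; rewrite /reduced size_alt.
move=> h /eqP <-; have := lenM (ev (alt s t (m s t))) (ev y).
have := reduced_alt st (leqnn _); rewrite /reduced size_alt => /eqP <-.
by rewrite -ev_cat; lia.
Qed.

(** * Positive words and Matsumoto's theorem *)

Lemma pos_eq_cat x x' y y' :
  pos_eq m x x' -> pos_eq m y y' -> pos_eq m (x ++ y) (x' ++ y').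
Proof.
move=> xx' yy'; apply: (@pos_trans _ _ _ (x' ++ y)).
  elim: xx' => [z|z t _ h|z t u _ h _ k|z t a b].
  - exact: pos_refl.
  - exact: pos_sym.
  - exact: pos_trans h k.
  - rewrite -!catA; exact: pos_braid.
elim: yy' => [z|z t _ h|z t u _ h _ k|z t a b].
- exact: pos_refl.
- exact: pos_sym.
- exact: pos_trans h k.
- rewrite !(catA x' z); exact: pos_braid.
Qed.

Lemma pos_eq_cons s x y : pos_eq m x y -> pos_eq m (s :: x) (s :: y).
Proof. exact: (pos_eq_cat (pos_refl m [:: s])). Qed.

Lemma pos_eq_ev x y : pos_eq m x y -> ev x = ev y.
Proof.
elim=> // [{}x {}y z _ -> _ -> //|{}x {}y s t].
by rewrite !ev_cat ev_alt_braid.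
Qed.

Lemma pos_eq_size x y : pos_eq m x y -> size x = size y.
Proof.
elim=> // [{}x {}y z _ -> _ -> //|{}x {}y s t].
by rewrite !size_cat !size_alt.
Qed.

(** Induction on length. If the first letters differ, both are descents of the element, which
    therefore begins with the full alternating word. Each word is compared by induction with the
    form of that alternating word starting with its own letter, and one braid relation links the two
    forms. *)
Lemma matsumoto x y : reduced x -> reduced y -> ev x = ev y -> pos_eq m x y.
Proof.
have [n] := ubnP (size x); elim: n x y => // n IH [|s x] [|t y] // xn rx ry e.
- exact: pos_refl.
- by move: ry; rewrite /reduced -e ev_nil len1.
- by move: rx; rewrite /reduced e ev_nil len1.
have [sx rx'] := reduced_cons rx; have [ty ry'] := reduced_cons ry.
have [st|st] := eqVneq s t.
  rewrite -st in e ry *; apply: pos_eq_cons.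
  by apply: IH => //; apply: (mulgI (gen s)); rewrite -!ev_cons.
have sw : pre (gen s) (ev (s :: x)) by rewrite ev_cons adds_pre.
have tw : pre (gen t) (ev (s :: x)) by rewrite e ev_cons adds_pre.
have /preP[u au eu] := pre_alt st sw tw.
have ra : reduced (alt s t (m s t) ++ rword u).
  rewrite /reduced ev_cat rwordK size_cat (eqP (reduced_alt st (leqnn _))).
  by rewrite size_rword eq_sym.
have ra' : reduced (alt t s (m s t) ++ rword u).
  move: ra; rewrite /reduced !size_cat !size_alt ev_cat ev_alt_braid -ev_cat.
  by [].
have sz : size (t :: y) = size (s :: x) by rewrite (eqP ry) -e -(eqP rx).
case em : (m s t) (cox_mx_gt0 Hm s t) => [//|k] _; rewrite em in eu au ra ra'.
have [_ r1] := reduced_cons ra; have [_ r2] := reduced_cons ra'.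
apply: (@pos_trans _ _ _ (alt s t k.+1 ++ rword u)).
  apply: pos_eq_cons; apply: IH => //; apply: (mulgI (gen s)); rewrite -!ev_cons eu.
  by rewrite -[in RHS]cat_cons ev_cat rwordK.
apply: (@pos_trans _ _ _ (alt t s k.+1 ++ rword u)).
  by have := pos_braid m [::] (rword u) s t; rewrite em.
apply/pos_eq_cons/pos_sym; apply: IH => //; first by case: sz xn => ->.
apply: (mulgI (gen t)); rewrite -!ev_cons -e eu -[in RHS]cat_cons [RHS]ev_cat rwordK.
by have := ev_alt_braid s t; rewrite em => ->.
Qed.

Lemma pos_eq_rword_cat v w : adds v w -> pos_eq m (rword v ++ rword w) (rword (v * w)).
Proof.
move=> vw; apply: matsumoto; rewrite ?reduced_rword ?reduced_rword_cat //.
by rewrite ev_cat !rwordK.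
Qed.

(** Removing a common descent [s] gives, by induction, a greatest common divisor among those
    starting with [s]. For another common descent [t], the divisor [z'] obtained from [t] is above
    the full alternating word of [s] and [t]; hence it also starts with [s] and lies below [z]. *)
Lemma meet_exists u v : exists z, [/\ pre z u, pre z v &
  forall x : W, pre x u -> pre x v -> pre x z].
Proof.
have [n] := ubnP (len u); elim: n u v => // n IH u v un.
have step s : pre (gen s) u -> pre (gen s) v -> exists z, [/\ pre z u, pre z v &
    forall x : W, adds (gen s) x -> pre (gen s * x) u -> pre (gen s * x) v ->
      pre (gen s * x) z].
  case/preP=> u' su' eu /preP[v' sv' ev'].
  have [|z [zu zv zmax]] := IH u' v'.
    by move: un; rewrite eu (eqP su') len_gen.
  exists (gen s * z); rewrite eu ev' !pre_mul2l //; split=> // x sx xu xv.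
  apply: pre_mul2l; first exact: adds_preW zu.
  by apply: zmax; apply: pre_mulI sx _.
have [[s [su sv]]|none] := excluded_middle_informative
    (exists s, pre (gen s) u /\ pre (gen s) v); last first.
  exists 1; rewrite !pre1w; split=> // x xu xv.
  have [->|/descent[s sx]] := eqVneq x 1; first exact: pre_refl.
  by case: none; exists s; split; apply: pre_trans sx _.
have [z [zu zv zmax]] := step s su sv; exists z; split=> // x xu xv.
have [->|/descent[t tx]] := eqVneq x 1; first exact: pre1w.
have tu := pre_trans tx xu; have tv := pre_trans tx xv.
have [st|st] := eqVneq s t.
  by rewrite -st in tx; case/preP: tx xu xv => x' tx' -> xu xv; apply: zmax.
have [z' [zu' zv' zmax']] := step t tu tv.
have xz' : pre x z' by case/preP: tx xu xv => x' tx' -> xu xv; apply: zmax'.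
apply: pre_trans xz' _.
have : pre (gen s) z'.
  have altP w : pre (gen s) w -> pre (gen t) w -> pre (ev (alt s t (m s t))) w.
    exact: pre_alt.
  have h : pre (ev (alt s t (m s t))) z'.
    have := altP _ su tu; have := altP _ sv tv; rewrite ev_alt_braid.
    have := reduced_alt (s := t) (t := s) (k := m s t).
    rewrite eq_sym st (cox_mxC Hm t s) leqnn => /(_ isT isT).
    case em : (m s t) (cox_mx_gt0 Hm s t) => [//|k] _ /reduced_cons[h _].
    by rewrite ev_cons => hv hu; apply: zmax'.
  apply: pre_trans h.
  have := reduced_alt st (leqnn _).
  case em : (m s t) (cox_mx_gt0 Hm s t) => [//|k] _ /reduced_cons[h _].
  by rewrite ev_cons adds_pre.
by case/preP=> x' sx' e; rewrite e in zu' zv' *; apply: zmax.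
Qed.

Definition meet u v : W :=
  sval (constructive_indefinite_description _ (meet_exists u v)).

Lemma meetP u v : [/\ pre (meet u v) u, pre (meet u v) v &
  forall x : W, pre x u -> pre x v -> pre x (meet u v)].
Proof. by rewrite /meet; case: constructive_indefinite_description. Qed.

Lemma meet_l u v : pre (meet u v) u. Proof. by case: (meetP u v). Qed.
Lemma meet_r u v : pre (meet u v) v. Proof. by case: (meetP u v). Qed.
Lemma meet_max u v w : pre w u -> pre w v -> pre w (meet u v).
Proof. by case: (meetP u v) => _ _; apply. Qed.

Lemma meet_eq u v z : pre z u -> pre z v ->
  (forall w, pre w u -> pre w v -> pre w z) -> meet u v = z.
Proof.
move=> zu zv zmax; apply: pre_anti; last exact: meet_max.
by apply: zmax; rewrite ?meet_l ?meet_r.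
Qed.

End WeakOrder.

(** * Words in the Artin group *)

Section GroupWords.
Variables (S : finType) (m : S -> S -> nat) (D : seq S).
Implicit Types (g h k : gword S) (x y : seq S).

Lemma grp_eq_cat g g' h h' :
  grp_eq m g g' -> grp_eq m h h' -> grp_eq m (g ++ h) (g' ++ h').
Proof.
move=> gg' hh'; apply: (@grp_trans _ _ _ (g' ++ h)).
  elim: gg' => [z|z t _ e|z t u _ e _ e'|z t a b|z t a b].
  - exact: grp_refl.
  - exact: grp_sym.
  - exact: grp_trans e e'.
  - rewrite -!catA; exact: grp_braid.
  - rewrite -!catA; exact: grp_cancel.
elim: hh' => [z|z t _ e|z t u _ e _ e'|z t a b|z t a b].
- exact: grp_refl.
- exact: grp_sym.
- exact: grp_trans e e'.
- rewrite !(catA g' z); exact: grp_braid.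
- rewrite !(catA g' z); exact: grp_cancel.
Qed.

Lemma grp_eq_catl g h h' : grp_eq m h h' -> grp_eq m (g ++ h) (g ++ h').
Proof. exact: grp_eq_cat (grp_refl m g). Qed.

Lemma grp_eq_catr g h h' : grp_eq m h h' -> grp_eq m (h ++ g) (h' ++ g).
Proof. by move/grp_eq_cat; apply; apply: grp_refl. Qed.

Lemma pos_cat x y : pos (x ++ y) = pos x ++ pos y. Proof. exact: map_cat. Qed.

Lemma pos_eq_grp x y : pos_eq m x y -> grp_eq m (pos x) (pos y).
Proof.
elim=> [z|z t _ e|z t u _ e _ e'|z t a b].
- exact: grp_refl.
- exact: grp_sym.
- exact: grp_trans e e'.
- rewrite !pos_cat; exact: grp_braid.
Qed.

Lemma ginv_cat g h : ginv (g ++ h) = ginv h ++ ginv g.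
Proof. by rewrite /ginv map_cat rev_cat. Qed.

Lemma ginvK : involutive (@ginv S).
Proof.
move=> g; rewrite /ginv map_rev revK -map_comp -[RHS]map_id.
by apply: eq_map => -[s b] /=; rewrite negbK.
Qed.

Lemma grp_eq_invr g : grp_eq m (g ++ ginv g) [::].
Proof.
elim: g => [|[s b] g IH]; first exact: grp_refl.
rewrite -cat1s ginv_cat -catA (catA g).
apply: grp_trans (grp_cancel m [::] [::] s b).
apply: (grp_eq_catl [:: (s, b)]).
exact: (grp_eq_catr [:: (s, ~~ b)] IH).
Qed.

Lemma grp_eq_invl g : grp_eq m (ginv g ++ g) [::].
Proof. by rewrite -{2}(ginvK g); apply: grp_eq_invr. Qed.

Lemma grp_eq_mulK g h : grp_eq m (g ++ ginv g ++ h) h.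
Proof. by rewrite catA; apply: (grp_eq_catr h (grp_eq_invr g)). Qed.

Lemma grp_eq_mulVK g h : grp_eq m (ginv g ++ g ++ h) h.
Proof. by rewrite catA; apply: (grp_eq_catr h (grp_eq_invl g)). Qed.

Lemma DpowD a b : Dpow D (a + b) = Dpow D a ++ Dpow D b.
Proof. by rewrite /Dpow nseqD flatten_cat. Qed.

Local Notation Delta a := (pos (Dpow D a)).

(** Nonnegative powers on both sides replace the sign of the exponent, so that symmetry and
    transitivity become direct. *)
Lemma same_vertexP g h :
  same_vertex m D g h <-> exists a b, grp_eq m (g ++ Delta a) (h ++ Delta b).
Proof.
split=> [[a [e|e]]|[a [b e]]].
- exists a, 0; rewrite cats0; apply: grp_trans (grp_eq_mulK g h).
  exact/grp_eq_catl/grp_sym.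
- exists 0, a; rewrite cats0; apply: grp_sym.
  apply: grp_trans (grp_eq_catr _ (grp_sym (grp_eq_mulK g h))) _.
  rewrite -!catA -[X in grp_eq _ _ X]cats0; apply: grp_eq_catl.
  rewrite catA; apply: grp_trans (grp_eq_catr _ e) (grp_eq_invl _).
have e' : grp_eq m (ginv g ++ h) (Delta a ++ ginv (Delta b)).
  have e1 : grp_eq m (ginv g ++ h ++ Delta b) (Delta a).
    exact: grp_trans (grp_eq_catl (ginv g) (grp_sym e)) (grp_eq_mulVK g _).
  apply: grp_trans (grp_eq_catr (ginv (Delta b)) e1); rewrite -!catA.
  apply/grp_eq_catl/grp_sym; rewrite -[X in grp_eq _ _ X]cats0.
  exact/grp_eq_catl/grp_eq_invr.
have [le_ba|/ltnW le_ab] := leqP b a.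
  exists (a - b); left; apply: grp_trans e' _.
  rewrite -{1}(subnK le_ba) DpowD pos_cat -catA -[X in grp_eq _ _ X]cats0.
  exact/grp_eq_catl/grp_eq_invr.
exists (b - a); right; apply: grp_trans e' _.
by rewrite -{1}(subnK le_ab) DpowD pos_cat ginv_cat; apply: grp_eq_mulK.
Qed.

Lemma grp_eq_same_vertex g h : grp_eq m g h -> same_vertex m D g h.
Proof. by move=> e; apply/same_vertexP; exists 0, 0; rewrite !cats0. Qed.

Lemma same_vertex_sym g h : same_vertex m D g h -> same_vertex m D h g.
Proof.
by case/same_vertexP=> a [b /grp_sym e]; apply/same_vertexP; exists b, a.
Qed.

Lemma same_vertex_trans g h k :
  same_vertex m D g h -> same_vertex m D h k -> same_vertex m D g k.
Proof.
case/same_vertexP=> a [b e] /same_vertexP[c [d e']]; apply/same_vertexP.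
exists (a + c), (d + b); rewrite !DpowD !pos_cat.
have := grp_eq_catr (Delta c) e; rewrite -catA => /grp_trans; apply.
rewrite -catA -pos_cat -DpowD addnC DpowD pos_cat !catA.
exact: grp_eq_catr.
Qed.

Lemma same_vertex_catl k g h : same_vertex m D g h -> same_vertex m D (k ++ g) (k ++ h).
Proof.
case/same_vertexP=> a [b e]; apply/same_vertexP; exists a, b; rewrite -!catA.
exact: grp_eq_catl.
Qed.
End GroupWords.

(** * The longest element *)

Section GreedyLists.
Variables (S : finType) (m : S -> S -> nat) (Hm : coxeter_matrix m).
Variables (D : seq S) (HD : is_Delta m D).
Local Open Scope group_scope.
Local Notation W := (coxgroup Hm).
Local Notation ev := (ev Hm).
Local Notation gen := (gen Hm).
Local Notation reduced := (reduced Hm).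
Implicit Types (u v w A B : W) (x y : seq S) (s t : S) (l k : seq W).

Definition w0 : W := ev D.

Lemma reduced_Delta : reduced D. Proof. by apply/atomP; case: HD. Qed.

Lemma len_le_w0 w : len w <= len w0.
Proof.
rewrite -(eqP reduced_Delta) -size_rword; case: HD => _; apply.
exact/(atomP Hm)/reduced_rword.
Qed.

(* If [w * s] were longer than [w] without being a prefix of [w0 = w * y], then
   the reflection [t = w s w^-1] would be inverted by [w s y], and
   [w s y = t w0] would be longer than [w0]. *)
Lemma pre_w0_step w s : adds w (gen s) -> pre w w0 -> pre (w * gen s) w0.
Proof.
move=> ws /preP[y wy e]; rewrite e; apply: pre_mul2l => //.
rewrite pre_gen; apply: contraT; rewrite -leqNgt => sy.
pose t := w * gen s * w^-1.
have tw : t ^ w = gen s by rewrite conjgE /t !mulgA mulVg mul1g mulgVK.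
have pw : refl_parity (rword w) t = false.
  apply/negP => /refl_parity_shorter; rewrite rwordK size_rword /t mulgVK.
  by rewrite (eqP ws) len_gen addn1 ltnNge leqnSn.
have py : refl_parity (rword y) (gen s) = false.
  by apply/negP => /refl_parity_shorter; rewrite rwordK size_rword ltnNge sy.
have : refl_parity (rword (w * gen s * y)) t.
  rewrite (@refl_parity_ev _ _ _ _ (rword w ++ [:: s] ++ rword y)); last first.
    by rewrite !ev_cat !rwordK mulgA.
  rewrite !refl_parity_cat rwordK tw pw conjgE -/(gen s) mulKg py.
  by rewrite /refl_parity /= eqxx.
move/refl_parity_shorter; rewrite rwordK size_rword /t.
have -> : w * gen s * w^-1 * (w * gen s * y) = w0.
  by rewrite e !mulgA mulgVK -(mulgA w) gen_sqr mulg1.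
by rewrite ltnNge len_le_w0.
Qed.

Lemma pre_w0 w : pre w w0.
Proof.
rewrite -(rwordK w); move: (reduced_rword w); elim/last_ind: (rword w) => [|x s IH].
  by rewrite ev_nil pre1w.
move=> r; have := r; rewrite -cats1 ev_cat => /reduced_cat[rx _].
apply: pre_w0_step (IH rx); move: r; rewrite /reduced -cats1 ev_cat size_cat.
by rewrite (eqP rx) /adds len_gen eq_sym.
Qed.

Definition compl w : W := w^-1 * w0.

Lemma adds_compl w : adds w (compl w). Proof. exact: pre_w0. Qed.

Lemma mul_compl w : w * compl w = w0. Proof. exact: mulVKg. Qed.

Lemma len_compl w : len w + len (compl w) = len w0.
Proof. by rewrite -(eqP (adds_compl w)) mul_compl. Qed.

(** If the lengths add, [v * w] divides [w0 = v * compl v], and [v] cancels. This turns additivity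
    into divisibility, so that [carry] can be computed as a meet. *)
Lemma adds_preC v w : adds v w = pre w (compl v).
Proof.
apply/idP/idP => [h|]; last exact: adds_preW (adds_compl v).
by apply: (pre_mulI h); rewrite mul_compl pre_w0.
Qed.

Lemma w0_sqr : w0 * w0 = 1.
Proof.
apply/eqP; rewrite -len_eq0 -{1}(invgK w0) -/(compl w0^-1).
by have := len_compl w0^-1; rewrite lenV -[RHS]addn0 => /addnI ->.
Qed.

Lemma w0V : w0^-1 = w0. Proof. exact/mulg1_eq/w0_sqr. Qed.

Lemma w0K w : w0 * (w0 * w) = w. Proof. by rewrite mulgA w0_sqr mul1g. Qed.

Definition cj w : W := w0 * w * w0.

Lemma cjM v w : cj (v * w) = cj v * cj w.
Proof. by rewrite /cj -!mulgA w0K. Qed.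

Lemma cjK : involutive cj.
Proof. by move=> w; rewrite /cj -!mulgA w0_sqr mulg1 w0K. Qed.

Lemma cj1 : cj 1 = 1. Proof. by rewrite /cj mulg1 w0_sqr. Qed.
Lemma cjV w : cj w^-1 = (cj w)^-1.
Proof. by rewrite /cj !invgM w0V mulgA. Qed.
Lemma cj_w0 : cj w0 = w0. Proof. by rewrite /cj w0_sqr mul1g. Qed.
Lemma cj_eq1 w : (cj w == 1) = (w == 1).
Proof. by rewrite -{1}cj1 (inj_eq (inv_inj cjK)). Qed.
Lemma cj_eqw0 w : (cj w == w0) = (w == w0).
Proof. by rewrite -{1}cj_w0 (inj_eq (inv_inj cjK)). Qed.

(** [cj w] is the inverse of the complement of [w * w0], whose length is [len w0 - len w]. *)
Lemma len_cj w : len (cj w) = len w.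
Proof.
have e1 := len_compl (w * w0); have e2 := len_compl w^-1.
rewrite /compl invgK lenV in e2.
have -> : cj w = (compl (w * w0))^-1 by rewrite /compl invgM invgK w0V /cj mulgA.
by rewrite lenV; apply: (@addnI (len (w * w0))); rewrite e1 -e2 addnC.
Qed.

Lemma adds_cj v w : adds (cj v) (cj w) = adds v w.
Proof. by rewrite /adds -cjM !len_cj. Qed.

Lemma pre_cj v w : pre (cj v) (cj w) = pre v w.
Proof. by rewrite /pre -cjV -cjM adds_cj. Qed.

Lemma meet_cj v w : meet (cj v) (cj w) = cj (meet v w).
Proof.
apply: meet_eq; rewrite ?pre_cj ?meet_l ?meet_r // => u.
by rewrite -(cjK u) !pre_cj => uv uw; rewrite meet_max.
Qed.

Lemma compl_cj w : compl (cj w) = cj (compl w).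
Proof. by rewrite /compl cjM cjV cj_w0. Qed.

(** * Left multiplication on greedy normal forms *)

Definition head1 l : W := head 1 l.

(* [tight A B]: the atom of [A] is the largest one dividing [A B]. *)
Definition tight A B := forall w, pre w B -> adds A w -> w = 1.

Fixpoint normal l : Prop :=
  if l is A :: l' then [/\ A != 1, tight A (head1 l') & normal l'] else True.

(* [carry w A] is the part of [A] absorbed when [A] is multiplied by [w] on the
   left: the largest atom dividing [w A] is [w * carry w A]. *)
Definition carry w A : W := meet A (compl w).

Fixpoint push w l : seq W :=
  if l is A :: l' then (w * carry w A) :: push ((carry w A)^-1 * A) l'
  else if w == 1 then [::] else [:: w].

Lemma adds_carry w A : adds w (carry w A).
Proof. by rewrite adds_preC meet_r. Qed.

Lemma pre_carry w A : pre (carry w A) A. Proof. exact: meet_l. Qed.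

Lemma carry_max w A u : pre u A -> adds w u -> pre u (carry w A).
Proof. by rewrite adds_preC; apply: meet_max. Qed.

Lemma carry_adds w A : adds w A -> carry w A = A.
Proof.
by move=> h; apply: pre_anti; [exact: pre_carry|exact: carry_max (pre_refl _) h].
Qed.

Lemma carry_w1 w : carry w 1 = 1. Proof. by apply/carry_adds/addsw1. Qed.

Lemma head_push w l : head1 (push w l) = w * carry w (head1 l).
Proof.
by case: l => //=; rewrite /head1 /= carry_w1 mulg1; case: eqVneq.
Qed.

Lemma push1 l : push 1 l = l.
Proof.
elim: l => [|A l IH] /=; first by rewrite eqxx.
by rewrite carry_adds ?adds1w // mul1g mulVg IH.
Qed.

(** Write [A = p q], with [p] absorbed by [w], and let [z] extend the new head [w p] inside [q r].
    The part of [q r] that can follow [p] is some [q c]; then [c] divides [B] and extends [A], so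
    [c = 1] by tightness. Hence [z] divides [q], [p z] divides [A] and can follow [w], and
    maximality of [p] gives [z = 1]. *)
Lemma tight_push w A B : tight A B ->
  tight (w * carry w A) ((carry w A)^-1 * A * carry ((carry w A)^-1 * A) B).
Proof.
set p := carry w A; set q := p^-1 * A; set r := carry q B => AB z zqr wpz.
have wp : adds w p := adds_carry w A.
have pq : adds p q := pre_carry w A.
have eA : A = p * q by rewrite mulVKg.
have qr : adds q r := adds_carry q B.
have /andP[pz wpz'] : adds p z && adds w (p * z) by rewrite -addsA wp wpz.
have zM : pre z (meet (q * r) (compl p)) by rewrite meet_max // -adds_preC.
have /preP[c qc eM] : pre q (meet (q * r) (compl p)).
  by rewrite meet_max -?adds_preC // adds_pre.
have Mc : adds p (q * c) by rewrite -eM adds_preC meet_r.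
have c1 : c = 1.
  apply: AB; last by have := addsA p q c; rewrite pq qc Mc -eA /= => ->.
  apply: pre_trans (pre_carry q B); apply: (pre_mulI qc).
  by rewrite -eM meet_l.
have zq : pre z q by move: zM; rewrite eM c1 mulg1.
have : pre (p * z) p by apply: carry_max; rewrite // eA pre_mul2l.
move/pre_len; rewrite (eqP pz) -[X in _ <= X]addn0 leq_add2l leqn0 len_eq0.
by move/eqP.
Qed.

Lemma mul_carry_neq1 w A : A != 1 -> w * carry w A != 1.
Proof.
rewrite -!len_eq0 (eqP (adds_carry w A)) addn_eq0 !len_eq0 => A1.
apply/negP => /andP[/eqP-> /eqP]; rewrite carry_adds ?adds1w // => e.
by rewrite e eqxx in A1.
Qed.

Lemma normal_push w l : normal l -> normal (push w l).
Proof.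
elim: l w => [|A l IH] w /=; first by case: eqVneq => //= w1 _; split=> // u /pre_w1.
case=> A1 AB /IH nl; split; rewrite ?mul_carry_neq1 //.
by rewrite head_push; apply: tight_push.
Qed.

Lemma push_normal A l : A != 1 -> tight A (head1 l) -> normal l -> push A l = A :: l.
Proof.
elim: l A => [|B l IH] A A1 /=; first by rewrite (negbTE A1).
move=> AB [B1 BC nl]; have -> : carry A B = 1.
  by apply: AB; [exact: pre_carry|exact: adds_carry].
by rewrite mulg1 invg1 mul1g IH.
Qed.

(** After [w] absorbs [p] from [A], [v] absorbs [w z] from [w p] with [z] a prefix of [p];
    maximality makes [z] what [v * w] absorbs from [A] directly. The leftover [z^-1 A] is the atom
    product of [z^-1 p] and [p^-1 A], to which the induction hypothesis applies. *)
Lemma push_adds v w l : adds v w -> push (v * w) l = push v (push w l).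
Proof.
elim: l v w => [|A l IH] v w vw /=.
  have [->|w1] := eqVneq w 1; first by rewrite mulg1.
  rewrite /= carry_adds // mulVg eqxx.
  by rewrite -len_eq0 (eqP vw) addn_eq0 !len_eq0 (negbTE w1) andbF.
set p := carry w A; set q := carry v (w * p).
have wp : adds w p := adds_carry w A.
have wq : pre w q by apply: carry_max; rewrite ?adds_pre.
case/preP: wq (wq) => z wz eq _.
have zp : pre z p by apply: (pre_mulI wz); rewrite -eq pre_carry.
have vwz : adds v (w * z) by rewrite -eq adds_carry.
have -> : carry (v * w) A = z.
  apply: pre_anti; last first.
    apply: carry_max; first exact: pre_trans zp (pre_carry _ _).
    by have := addsA v w z; rewrite vw wz vwz /= => ->.
  have : adds v w && adds (v * w) (carry (v * w) A) by rewrite vw adds_carry.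
  rewrite addsA => /andP[wr vwr]; apply: (pre_mulI wr); rewrite -eq.
  apply: carry_max => //; apply: pre_mul2l => //.
  by apply: carry_max; rewrite ?pre_carry.
have e1 : z^-1 * A = (w * z)^-1 * (w * p) * (p^-1 * A).
  by rewrite invgM -!mulgA mulKg mulVKg.
rewrite eq mulgA e1 IH //.
case/preP: zp => b zb ep; have /preP[a pa ->] : pre p A := pre_carry w A.
have -> : (w * z)^-1 * (w * p) = b by rewrite ep (mulgA w) mulKg.
rewrite mulKg; rewrite ep in pa.
by have := addsA z b a; rewrite zb pa => /esym/andP[].
Qed.

(** * Positive words and their greedy normal forms *)

Definition mulword x l := foldr (fun s => push (gen s)) l x.
Definition mull k l := foldr push l k.
Definition words l : seq S := flatten [seq rword A | A <- l].
Definition nf x := mulword x [::].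

Lemma mulword_cat x y l : mulword (x ++ y) l = mulword x (mulword y l).
Proof. exact: foldr_cat. Qed.

Lemma mull_cat k1 k2 l : mull (k1 ++ k2) l = mull k1 (mull k2 l).
Proof. exact: foldr_cat. Qed.

Lemma normal_mulword x l : normal l -> normal (mulword x l).
Proof. by move=> nl; elim: x => //= s x; apply: normal_push. Qed.

Lemma normal_mull k l : normal l -> normal (mull k l).
Proof. by move=> nl; elim: k => //= A k; apply: normal_push. Qed.

Lemma normal_nf x : normal (nf x). Proof. exact: normal_mulword. Qed.

Lemma mulword_reduced x l : reduced x -> mulword x l = push (ev x) l.
Proof.
elim: x => [|s x IH] r; first by rewrite ev_nil push1.
have [sx rx] := reduced_cons r.
by rewrite /= -/(mulword x l) IH // ev_cons push_adds.
Qed.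

Lemma mulword_rword w l : mulword (rword w) l = push w l.
Proof. by rewrite mulword_reduced ?reduced_rword // rwordK. Qed.

Lemma mulword_words k l : mulword (words k) l = mull k l.
Proof.
by elim: k => //= A k IH; rewrite /words /= mulword_cat mulword_rword -/(words k) IH.
Qed.

(** The two sides of a braid relation are reduced words of one element, and a reduced word acts as
    the single push of its element. *)
Lemma mulword_pos_eq x y l : pos_eq m x y -> mulword x l = mulword y l.
Proof.
elim=> // [{}x {}y z _ -> _ -> //|{}x {}y s t].
rewrite !mulword_cat; have [->//|st] := eqVneq s t.
have rs := reduced_alt Hm st (leqnn _).
have rt : reduced (alt t s (m s t)).
  by rewrite (cox_mxC Hm) reduced_alt // eq_sym.
by rewrite !(mulword_reduced _ rs, mulword_reduced _ rt) ev_alt_braid.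
Qed.

Lemma words_push w l : pos_eq m (rword w ++ words l) (words (push w l)).
Proof.
elim: l w => [|A l IH] w /=.
  have [->|_] := eqVneq w 1; last exact: pos_refl.
  have /eqP := size_rword (1 : W); rewrite len1 size_eq0 => /eqP->.
  exact: pos_refl.
rewrite /words /= -/(words _) -/(words _).
apply: (@pos_trans _ _ _ ((rword w ++ rword (carry w A))
                          ++ rword ((carry w A)^-1 * A) ++ words l)); last first.
  by apply: pos_eq_cat; [apply/pos_eq_rword_cat/adds_carry|exact: IH].
rewrite -catA; apply: pos_eq_cat; first exact: pos_refl.
rewrite catA; apply: pos_eq_cat; last exact: pos_refl.
by apply: pos_sym; have := pos_eq_rword_cat (pre_carry w A); rewrite mulVKg.
Qed.

Lemma words_mulword x l : pos_eq m (x ++ words l) (words (mulword x l)).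
Proof.
elim: x => [|s x IH] /=; first exact: pos_refl.
have h : pos_eq m [:: s] (rword (gen s)).
  apply: (@matsumoto _ _ Hm); rewrite ?reduced_rword ?rwordK //.
  by rewrite /reduced -/(gen s) len_gen.
exact: pos_trans (pos_eq_cat h IH) (words_push _ _).
Qed.

Lemma words_nf x : pos_eq m x (words (nf x)).
Proof. by have := words_mulword x [::]; rewrite cats0. Qed.

Lemma nf_inj x y : nf x = nf y -> pos_eq m x y.
Proof.
by move=> e; apply: pos_trans (words_nf x) _; rewrite e; apply/pos_sym/words_nf.
Qed.

Lemma mull_normal k l : normal (k ++ l) -> mull k l = k ++ l.
Proof.
elim: k => //= A k IH [A1 AB nl]; rewrite IH //; exact: push_normal.
Qed.

Lemma nf_words l : normal l -> nf (words l) = l.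
Proof.
by move=> nl; rewrite /nf mulword_words -[RHS]cats0 mull_normal ?cats0.
Qed.

Lemma normal_take i l : normal l -> normal (take i l).
Proof.
elim: l i => [|A l IH] [|i] //= [A1 AB nl]; split=> //; last exact: IH.
by case: l i AB {IH nl} => [|B l] [|i] //= _ u /pre_w1.
Qed.

Lemma normal_cat k l : normal (k ++ l) -> normal l.
Proof. by elim: k => //= A k IH [_ _ /IH]. Qed.

Lemma normal_drop i l : normal l -> normal (drop i l).
Proof. by rewrite -{1}(cat_take_drop i l) => /normal_cat. Qed.

Lemma prec_size x y : prec m x y -> size x <= size y.
Proof. by case=> z /pos_eq_size <-; rewrite size_cat leq_addr. Qed.

Lemma prec_ev_head x z : reduced x -> prec m x z -> pre (ev x) (head1 (nf z)).
Proof.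
move=> rx [y /mulword_pos_eq e]; rewrite /nf -e mulword_cat mulword_reduced //.
by rewrite head_push; apply/adds_pre/adds_carry.
Qed.

Lemma pre_prec v w : pre v w -> prec m (rword v) (rword w).
Proof.
by case/preP=> u vu ->; exists (rword u); apply: pos_eq_rword_cat.
Qed.

Lemma prec_trans x y z : prec m x y -> prec m y z -> prec m x z.
Proof.
case=> a xa [b yb]; exists (a ++ b); rewrite catA; apply: pos_trans yb.
exact: pos_eq_cat xa (pos_refl _ _).
Qed.

Lemma alpha_rword A l : normal (A :: l) -> is_alpha m (rword A) (words (A :: l)).
Proof.
move=> nl; split; first by apply/atomP/reduced_rword.
split; first by exists (words l); apply: pos_refl.
move=> b /(atomP Hm) rb bA; apply: prec_trans (pre_prec (_ : pre (ev b) A)).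
  exists [::]; rewrite cats0; apply: (@matsumoto _ _ Hm) => //.
    exact: reduced_rword.
  by rewrite rwordK.
by have := prec_ev_head rb bA; rewrite nf_words.
Qed.

Lemma normal_form_words l : normal l -> normal_form m (words l) (map (@rword _ _ Hm) l).
Proof.
move=> nl; split; first exact: pos_refl; split.
  elim: l nl => //= A l IH [A1 _ /IH->]; rewrite size_rword andbT.
  by rewrite len_eq0.
move=> i; rewrite size_map => il; rewrite -map_drop (nth_map 1) //.
have := drop_nth 1 il; move: (normal_drop i nl) => /[swap] ->.
exact: alpha_rword.
Qed.

(** Maximality of alpha gives tightness: if [u] divides the next head and extends [A], then [A u] is
    an atom dividing the product, hence it divides [A], and its length forces [u = 1]. *)
Lemma normal_form_nf x (l : seq (seq S)) : normal_form m x l ->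
  map ev l = nf x /\ all reduced l.
Proof.
case=> e [nz al]; rewrite /nf -(mulword_pos_eq _ e) {e}.
elim: l nz al => //= A l IH /andP[A1 nz] al.
have [|el rl] := IH nz; first by move=> i il; have := al i.+1 il.
have [/(atomP Hm) rA [_ Amax]] := al 0 isT; rewrite /= in Amax.
rewrite rA rl; split=> //; rewrite mulword_cat mulword_reduced // -/(nf _) el.
rewrite push_normal //; [by rewrite -len_eq0 -(eqP rA)| |exact: normal_nf].
move=> u ul Au.
have rAu := reduced_rword (ev A * u).
have /prec_size : prec m (rword (ev A * u)) A.
  apply: Amax; first exact/atomP.
  apply: (@prec_trans _ (A ++ rword u)).
    exists [::]; rewrite cats0; apply/pos_sym/(@matsumoto _ _ Hm) => //.
      by rewrite /reduced size_cat ev_cat rwordK (eqP Au) size_rword -(eqP rA).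
    by rewrite ev_cat !rwordK.
  case: (nf (flatten l)) (words_nf (flatten l)) ul => [|B k] h /= ul.
    exists [::]; rewrite (pre_w1 ul) cats0; apply: pos_eq_cat; first exact: pos_refl.
    by rewrite (size0nil (_ : size (rword 1) = 0)) ?size_rword ?len1 //; apply: pos_sym.
  have [y uy] := pre_prec ul; exists (y ++ words k).
  rewrite -catA; apply: pos_eq_cat; first exact: pos_refl.
  apply: pos_trans (pos_sym h); rewrite catA.
  exact: pos_eq_cat uy (pos_refl _ _).
rewrite size_rword (eqP Au) -(eqP rA) -[X in _ <= X]addn0 leq_add2l leqn0 len_eq0.
by move/eqP.
Qed.

(** * The Artin group acting on vertices *)

Local Notation cjl := (map cj).
(* Fails only if [S] is empty. *)
Hypothesis w0_neq1 : w0 != 1.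

Lemma cjlK : involutive cjl.
Proof. by move=> l; rewrite -map_comp map_id_in // => A _ /=; apply: cjK. Qed.

Lemma head1_cj l : head1 (cjl l) = cj (head1 l).
Proof. by case: l => //=; rewrite /head1 /= cj1. Qed.

Lemma carry_cj w A : carry (cj w) (cj A) = cj (carry w A).
Proof. by rewrite /carry compl_cj meet_cj. Qed.

Lemma push_cj w l : push (cj w) (cjl l) = cjl (push w l).
Proof.
elim: l w => [|A l IH] w /=; first by rewrite cj_eq1; case: ifP.
by rewrite carry_cj -cjV -!cjM IH.
Qed.

Lemma normal_cj l : normal l -> normal (cjl l).
Proof.
elim: l => //= A l IH [A1 AB /IH nl]; rewrite cj_eq1; split=> // u.
rewrite head1_cj -(cjK u) pre_cj adds_cj => ul Au.
by rewrite (AB _ ul Au) cj1.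
Qed.

Lemma tight_w0 B : tight w0 B.
Proof.
move=> u _ /eqP e; have := len_le_w0 (w0 * u).
by rewrite e -[X in _ <= X]addn0 leq_add2l leqn0 len_eq0 => /eqP.
Qed.

Lemma push_w0 l : normal l -> push w0 l = w0 :: l.
Proof. by move=> nl; apply: push_normal => //; apply: tight_w0. Qed.

Lemma carry_w0 w : carry w w0 = compl w.
Proof. by apply: meet_eq; rewrite ?pre_w0 ?pre_refl. Qed.

Lemma compl_compl w : compl (compl w) = cj w.
Proof. by rewrite /compl invgM invgK w0V. Qed.

Lemma push_w0_cons w l : push w (w0 :: l) = w0 :: push (cj w) l.
Proof. by rewrite /= carry_w0 mul_compl -/(compl (compl w)) compl_compl. Qed.

Lemma mull_w0 l : normal l -> mull l [:: w0] = w0 :: cjl l.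
Proof.
elim: l => // A l IH nAl; have [A1 AB nl] := nAl.
by rewrite [LHS]/= IH // push_w0_cons push_cj push_normal.
Qed.

(* Since [Delta A = cj A Delta], dropping a leading [Delta] from a normal form
   without changing the vertex conjugates the remaining atoms. *)
Fixpoint strip l : seq W :=
  if l is A :: l' then if A == w0 then cjl (strip l') else l else [::].

Definition free l := normal l /\ head1 l != w0.

Lemma strip_id l : head1 l != w0 -> strip l = l.
Proof. by case: l => //= A l; rewrite /head1 /= => /negbTE->. Qed.

Lemma strip_cj l : strip (cjl l) = cjl (strip l).
Proof. by elim: l => //= A l IH; rewrite cj_eqw0 IH; case: ifP. Qed.

Lemma free_cj l : free l -> free (cjl l).
Proof. by case=> nl hl; split; [exact: normal_cj|rewrite head1_cj cj_eqw0]. Qed.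

Lemma free_nil : free [::]. Proof. by split=> //; rewrite eq_sym. Qed.

Lemma free_strip l : normal l -> free (strip l).
Proof.
elim: l => [|A l IH] nl; first exact: free_nil.
by have [A1 _ nl'] := nl; rewrite /=; case: (eqVneq A w0) => // _; apply/free_cj/IH.
Qed.

(** Pushing commutes with removal of Deltas up to a final removal, so the action on greedy lists
    descends to vertices. *)
Lemma strip_push w l : strip (push w (strip l)) = strip (push w l).
Proof.
elim: l w => // A l IH w; rewrite [strip (_ :: _)]/=; case: (eqVneq A w0) => [->|//].
rewrite push_w0_cons [RHS]/= eqxx -IH -!strip_cj -push_cj.
by rewrite cjK -strip_cj.
Qed.

(** From [s (compl s) = Delta] one gets [s^-1 = (compl s) Delta^-1], and on vertices [Delta^-1] acts
    by conjugation. *)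
Definition actl (a : S * bool) l :=
  if a.2 then strip (push (gen a.1) l) else strip (push (compl (gen a.1)) (cjl l)).

Definition act (g : gword S) l := foldr actl l g.

Lemma act_cat g h l : act (g ++ h) l = act g (act h l). Proof. exact: foldr_cat. Qed.

Lemma free_act g l : free l -> free (act g l).
Proof.
move=> fl; elim: g => // -[s b] g [IH _]; rewrite /= /actl /=.
by case: b; apply/free_strip/normal_push => //; apply: normal_cj.
Qed.

Lemma act_pos x l : free l -> act (pos x) l = strip (mulword x l).
Proof.
case=> nl hl; elim: x => [|s x IH] /=; first by rewrite strip_id.
by rewrite -/(act (pos x) l) IH /actl /= strip_push.
Qed.

Lemma actl_cancel s b l : free l -> actl (s, b) (actl (s, ~~ b) l) = l.
Proof.
case=> nl hl; rewrite /actl; case: b => /=.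
  rewrite strip_push -push_adds ?adds_compl // mul_compl.
  rewrite push_w0 /= ?eqxx ?strip_cj ?cjlK ?strip_id //; exact: normal_cj.
(* Here the conjugate of [gen s] appears; it is the complement of [compl (gen s)], so the product is
   again Delta. *)
rewrite -strip_cj strip_push -push_cj -compl_compl -push_adds ?adds_compl //.
rewrite mul_compl push_w0 /= ?eqxx ?strip_cj ?cjlK ?strip_id //; exact: normal_cj.
Qed.

Lemma act_grp_eq g h l : grp_eq m g h -> free l -> act g l = act h l.
Proof.
move=> e fl; elim: e => // [{}g {}h k' _ -> _ -> //|x y s t|x y s b].
  have fy : free (act y l) by apply: free_act.
  rewrite !act_cat; congr act; rewrite !act_pos //; congr strip.
  by apply: mulword_pos_eq; have := pos_braid m [::] [::] s t; rewrite !cats0.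
by rewrite !act_cat /= actl_cancel //; apply: free_act.
Qed.

Lemma act_invK g l : free l -> act (ginv g) (act g l) = l.
Proof. by move=> fl; rewrite -act_cat (act_grp_eq (grp_eq_invl m g)). Qed.

Lemma act_Dpow a l : free l -> act (pos (Dpow D a)) l = iter a cjl l.
Proof.
move=> fl; have fi i : free (iter i cjl l) by elim: i => //= i; apply: free_cj.
elim: a => //= a IH; rewrite [Dpow D _]/= pos_cat act_cat IH act_pos //.
have [ni hi] := fi a; rewrite mulword_reduced ?reduced_Delta // push_w0 //=.
by rewrite eqxx strip_id.
Qed.

Lemma act_same_vertex g h : same_vertex m D g h ->
  exists n, forall l, free l -> act h l = act g (iter n cjl l).
Proof.
have fi i l : free l -> free (iter i cjl l).
  by move=> fl; elim: i => //= i; apply: free_cj.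
(* Applying the relation to the [b]-fold conjugate of [l] gives [2 b] conjugations on the side of
   [h], which cancel, and [a + b] on the side of [g]. *)
case/same_vertexP=> a [b e]; exists (a + b) => l fl.
have := act_grp_eq e (fi b _ fl); rewrite !act_cat !act_Dpow; try exact: fi.
rewrite iterD => ->; rewrite -iterD addnn; congr act.
by elim: b {e} => //= b {1}->; rewrite cjlK.
Qed.

Definition vertex_nf g := act g [::].

Lemma vertex_nf_same g h : same_vertex m D g h -> vertex_nf h = vertex_nf g.
Proof.
case/act_same_vertex=> n e; rewrite /vertex_nf e; last exact: free_nil.
by congr act; elim: n {e} => //= n ->.
Qed.

Lemma free_vertex_nf g : free (vertex_nf g).
Proof. exact/free_act/free_nil. Qed.

Lemma pos_eq_Delta_words l : normal l ->
  pos_eq m (D ++ words l) (words (cjl l) ++ D).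
Proof.
move=> nl; apply: nf_inj; rewrite /nf !mulword_cat.
rewrite !(mulword_reduced _ reduced_Delta) [push _ [::]]push_w0 //.
rewrite !mulword_words mull_w0 ?cjlK; last exact: normal_cj.
by rewrite mull_normal ?cats0 // push_w0.
Qed.

Lemma same_vertex_strip l : normal l ->
  same_vertex m D (pos (words l)) (pos (words (strip l))).
Proof.
have [n] := ubnP (size l); elim: n l => // n IH [|A l] ln nl.
  exact/grp_eq_same_vertex/grp_refl.
rewrite /=; case: (eqVneq A w0) => [eA|_]; last exact/grp_eq_same_vertex/grp_refl.
have [_ _ nl'] := nl; rewrite -strip_cj.
apply: same_vertex_trans (IH _ _ (normal_cj nl')); last by rewrite size_map.
apply/same_vertexP; exists 0, 1%N; rewrite cats0 /Dpow /= cats0 -pos_cat.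
apply: pos_eq_grp; apply: pos_trans (pos_eq_Delta_words nl').
apply: pos_eq_cat (pos_refl _ _); apply: (@matsumoto _ _ Hm).
- exact: reduced_rword.
- exact: reduced_Delta.
- by rewrite rwordK eA.
Qed.

Lemma same_vertex_nf g : same_vertex m D g (pos (words (vertex_nf g))).
Proof.
elim: g => [|[s b] g IH]; first exact/grp_eq_same_vertex/grp_refl.
apply: same_vertex_trans (same_vertex_catl [:: (s, b)] IH) _.
rewrite -[vertex_nf (_ :: _)]/(actl (s, b) (vertex_nf g)); have [nl _] := free_vertex_nf g.
move: (vertex_nf g) nl => l nl; rewrite /actl /=; case: b.
  have nk := normal_push (gen s) nl.
  apply: same_vertex_trans (same_vertex_strip nk).
  exact/grp_eq_same_vertex/(pos_eq_grp (words_mulword [:: s] l)).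
have nc := normal_cj nl; have := normal_push (compl (gen s)) nc.
set k := push _ _ => nk; apply: same_vertex_trans (same_vertex_strip nk).
apply/same_vertexP; exists 1%N, 0; rewrite cats0 /Dpow /= cats0.
(* Both sides equal Delta times the conjugate of [l], since [s] and its complement multiply to
   Delta; cancelling [s] then shows that [k] represents [s^-1 l Delta]. *)
have e : pos_eq m (s :: words k) (words l ++ D).
  apply: (@pos_trans _ _ _ (D ++ words (cjl l))); last first.
    by have := pos_eq_Delta_words nc; rewrite cjlK.
  apply: nf_inj; rewrite -cat1s /nf !mulword_cat !mulword_words.
  rewrite (mulword_reduced _ reduced_Delta) !mull_normal ?cats0 //.
  by rewrite /= /k -push_adds ?adds_compl // mul_compl.
apply: grp_trans (grp_cancel m [::] (pos (words k)) s false).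
have := grp_eq_catl [:: (s, false)] (grp_sym (pos_eq_grp e)).
by rewrite pos_cat.
Qed.

(** * Special representatives and their norms *)

Lemma special_nf_ev g (l : seq (seq S)) : special_nf m D g l ->
  map ev l = vertex_nf g /\ all reduced l.
Proof.
case=> r [gr [nfr noD]]; have [el rl] := normal_form_nf nfr.
split=> //; rewrite -(vertex_nf_same gr) /vertex_nf act_pos; last exact: free_nil.
rewrite -/(nf r) -el strip_id //; case: l el rl noD {nfr} => [|A l] _ /=.
  by move=> *; rewrite eq_sym.
case/andP=> rA _ noD; apply/eqP => eA; apply: (noD A (mem_head _ _)).
apply: (@matsumoto _ _ Hm) => //; exact: reduced_Delta.
Qed.

Lemma special_nf_exists g : special_nf m D g (map (@rword _ _ Hm) (vertex_nf g)).
Proof.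
have [nl hl] := free_vertex_nf g; exists (words (vertex_nf g)).
split; first exact: same_vertex_nf; split; first exact: normal_form_words.
move=> _ /mapP[A Al ->] /(pos_eq_ev Hm); rewrite rwordK => eA.
elim: (vertex_nf g) nl hl Al => //= B l IH [B1 BC nl] hB; rewrite inE.
move/predU1P => [e|]; first by rewrite /head1 /= -e eA eqxx in hB.
(* If Delta came second, the head could absorb its own complement from it; by tightness the head
   would already be Delta. *)
apply: IH => //; apply/eqP => e; move: BC; rewrite e => /(_ (compl B)).
rewrite pre_w0 adds_compl // => /(_ isT isT) e1.
by have := mul_compl B; rewrite e1 mulg1 => eB; rewrite /head1 /= eB eqxx in hB.
Qed.

Definition wlen l := sumn (map (@len _ _ Hm) l).

Lemma snf_ofP g : size (snf_of m D g) = size (vertex_nf g) /\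
  size (flatten (snf_of m D g)) = wlen (vertex_nf g).
Proof.
have : special_nf m D g (snf_of m D g).
  (* Special normal forms are unique only up to the words chosen for their atoms; whichever is
     picked, its image is [vertex_nf g] and its words are reduced. *)
  apply: epsilon_spec; exists (map (@rword _ _ Hm) (vertex_nf g)).
  exact: special_nf_exists.
case/special_nf_ev=> <- rl; rewrite size_map; split=> //.
rewrite /wlen size_flatten /shape -map_comp; congr sumn.
by apply/eq_in_map => x /(allP rl)/eqP.
Qed.

Lemma d_atE g h : d_at m D g h = size (vertex_nf (ginv g ++ h)).
Proof. by rewrite /d_at; case: (snf_ofP (ginv g ++ h)). Qed.

Lemma d_wdE g h : d_wd m D g h = wlen (vertex_nf (ginv g ++ h)).
Proof. by rewrite /d_wd; case: (snf_ofP (ginv g ++ h)). Qed.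

(** * Distances along a geodesic *)

Lemma size_push w l : size (push w l) <= (size l).+1.
Proof. by elim: l w => [|A l IH] w /=; [case: ifP|exact: IH]. Qed.

Lemma wlen_push w l : wlen (push w l) = len w + wlen l.
Proof.
elim: l w => [|A l IH] w /=.
  by case: eqVneq => [->|_]; rewrite /wlen /= ?len1 ?addn0.
rewrite /wlen /= -/(wlen _) IH (eqP (adds_carry w A)) -/(wlen l) -!addnA.
congr (_ + _); rewrite addnA; congr (_ + _).
by rewrite -(eqP (pre_carry w A)) mulVKg.
Qed.

Lemma size_mull k l : size (mull k l) <= size k + size l.
Proof. by elim: k => //= A k IH; apply: leq_trans (size_push _ _) _. Qed.

Lemma wlen_mull k l : wlen (mull k l) = wlen k + wlen l.
Proof. by elim: k => //= A k IH; rewrite wlen_push IH addnA. Qed.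

Lemma mull_push w l k : mull (push w l) k = push w (mull l k).
Proof.
elim: l w => [|A l IH] w /=; first by case: eqVneq => [->|//]; rewrite push1.
rewrite IH push_adds ?adds_carry //.
by rewrite -(push_adds _ (pre_carry w A)) mulVKg.
Qed.

Lemma mull_mull (y l k : seq W) : mull (mull y l) k = mull y (mull l k).
Proof. by elim: y => //= A y IH; rewrite mull_push IH. Qed.

Lemma size_strip l : size (strip l) <= size l.
Proof. by elim: l => //= A l IH; case: ifP => //; rewrite size_map ltnW. Qed.

Lemma wlen_cj l : wlen (cjl l) = wlen l.
Proof.
rewrite /wlen -map_comp; congr sumn; apply: eq_map => A /=; exact: len_cj.
Qed.

Lemma head_mull (y l k : seq W) : head1 l = head1 k -> head1 (mull y l) = head1 (mull y k).
Proof. by move=> e; elim: y => //= A y IH; rewrite !head_push IH. Qed.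

Lemma size_le_wlen l : normal l -> size l <= wlen l.
Proof.
elim: l => //= A l IH [A1 _ /IH]; rewrite /wlen /= -/(wlen l); move: A1.
by rewrite -len_eq0; case: (len A) => // n _ h; rewrite addSn ltnS (leq_trans h) ?leq_addl.
Qed.

Lemma mull_nil l : normal l -> mull l [::] = l.
Proof. by move=> nl; rewrite mull_normal ?cats0. Qed.

Lemma mull_compl (y : seq W) B :
  mull (mull y (push B [::])) (push (compl B) [::]) = mull y [:: w0].
Proof.
rewrite mull_mull mull_push; congr mull.
by rewrite -[mull [::] _]/(push _ _) -push_adds ?adds_compl // mul_compl push_w0.
Qed.

(* With [z = y B], [y Delta = z (B^-1 Delta)] has one more factor than [y] and
   at most one more than [z]. *)
Lemma size_mull1 (y : seq W) B : normal y -> size y <= size (mull y (push B [::])).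
Proof.
move=> ny; have := size_mull (mull y (push B [::])) (push (compl B) [::]).
rewrite mull_compl mull_w0 // /= size_map => h; rewrite -ltnS (leq_trans h) //.
by rewrite -addn1 leq_add2l; case: ifP.
Qed.

Lemma mull_cons (y : seq W) B l : normal (B :: l) ->
  mull y (B :: l) = mull (mull y (push B [::])) l.
Proof. by case=> B1 BC nl; rewrite mull_mull mull_push /= push_normal. Qed.

Lemma size_mull_ge (y l : seq W) : normal y -> normal l -> size y <= size (mull y l).
Proof.
elim: l y => [|B l IH] y ny nl; first by rewrite mull_nil.
rewrite mull_cons //; have [_ _ nl'] := nl.
apply: leq_trans (size_mull1 B ny) (IH _ _ nl').
by apply/normal_mull/normal_push.
Qed.

Lemma free_take i l : free l -> free (take i l).
Proof.
case=> nl hl; split; first exact: normal_take.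
by case: l i {nl} hl => [|A l] [|i] //= _; rewrite /head1 /= eq_sym.
Qed.

(* If [t] began with [Delta], then so would [cj y], because
   [Delta (cj y) = y Delta = (y B) (B^-1 Delta)] would begin with [Delta^2]. *)
Lemma free_behead (y : seq W) B (t : seq W) :
  free y -> mull y (push B [::]) = w0 :: t -> free t.
Proof.
case=> ny hy e; have : normal (w0 :: t).
  by rewrite -e; apply/normal_mull/normal_push.
case=> _ _ nt; split=> //; apply/eqP => ht.
have := mull_compl y B; rewrite mull_w0 // e.
rewrite -[mull (_ :: _) _]/(push w0 (mull t _)) push_w0; last first.
  by apply/normal_mull/normal_push.
case: t ht {e} nt => [|A t] hA nt; rewrite /head1 /= in hA.
  by case/eqP: w0_neq1; rewrite hA.
have [_ _ nt'] := nt; rewrite -[mull (_ :: _) _]/(push A (mull t _)) hA push_w0; last first.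
  by apply/normal_mull/normal_push.
case=> ey; have := head1_cj y; rewrite -ey /head1 /= -/(head1 y) => ey'.
by case/eqP: hy; apply: (inv_inj cjK); rewrite -ey' cj_w0.
Qed.

(* As long as the next factor of [L] completes a [Delta], the vertex gets closer
   to the base point; once it does not, no later factor does either, because the
   first atom of [y L] depends only on [y] and the first atom of [L]. *)
Lemma geodesic_valley (L y : seq W) : free L -> free y ->
  let v i := strip (mull y (take i L)) in
  exists2 j, j <= size L &
    (forall i, i <= j -> size (v i) <= size y /\ wlen (v i) + i <= wlen y) /\
    (forall i, j <= i <= size L -> size (v i) <= size (v (size L)) /\
       wlen (v i) + (size L - i) <= wlen (v (size L))).
Proof.
elim: L y => [|B l IH] y fL fy v; have [ny hy] := fy.
  exists 0 => //; rewrite /v; split=> [i|i /andP[_ h]].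
    by rewrite leqn0 => /eqP->; rewrite take0 mull_nil // strip_id // addn0.
  by rewrite sub0n addn0.
have v0 : v 0 = y by rewrite /v take0 mull_nil // strip_id.
have [nL hB] := fL; have [B1 BC nl] := nL.
pose Y := mull y (push B [::]).
have nY : normal Y by apply/normal_mull/normal_push.
have [hY|hY] := eqVneq (head1 Y) w0.
  have [t eY] : exists t : seq W, Y = w0 :: t.
    case: Y hY {nY} => [|A t]; rewrite /head1 /= => e; last by exists t; rewrite e.
    by case/eqP: w0_neq1; rewrite e.
  have ft := free_behead fy eY; have [nt ht] := ft.
  have fl : free l.
    split=> //; apply/eqP => e; move: BC; rewrite e => /(_ (compl B)).
    rewrite pre_w0 adds_compl // => /(_ isT isT) e1.
    by have := mul_compl B; rewrite e1 mulg1 => eB; rewrite /head1 /= eB eqxx in hB.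
  (* Since [y B = Delta t], the rest of the path is, up to conjugation, the path along [l] starting
     from [t]. *)
  have vS i : v i.+1 = cjl (strip (mull t (take i l))).
    rewrite /v [take _ _]/= mull_cons; last exact: (normal_take i.+1 nL).
    rewrite -/Y eY /= push_w0 /= ?eqxx //.
    by apply/normal_mull/normal_take.
  have st : size t <= size y.
    have : size Y <= size y + 1.
      by apply: leq_trans (size_mull _ _) _; rewrite leq_add2l size_push.
    by rewrite eY /= addn1 ltnS.
  (* Word length is additive, so [len w0 + wlen t = wlen y + len B], and [B] is shorter than Delta
     because it is not Delta. *)
  have wt : wlen t < wlen y.
    have := wlen_mull y (push B [::]); rewrite -/Y eY wlen_push /wlen /= addn0.
    rewrite -!/(wlen _) => e; rewrite -(ltn_add2l (len w0)) e addnC ltn_add2r.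
    rewrite ltn_neqAle len_le_w0 andbT; apply: contraNneq hB => eB.
    by rewrite /head1 /= (pre_len_eq (pre_w0 B)) // eB.
  have [j jl [low high]] := IH t fl ft; exists j.+1 => //; split=> -[|i].
  - by rewrite v0 addn0.
  - rewrite ltnS vS wlen_cj size_map => /low[h1 h2]; split.
      exact: leq_trans h1 st.
    by rewrite addnS (leq_ltn_trans h2).
  - by [].
  - by rewrite /= !ltnS !vS !wlen_cj !size_map subSS; apply: high.
(* From here on the path only climbs: every nonempty prefix gives the same head as [B] alone, so
   nothing is stripped and the turning index is 0. *)
have vE i : v i = mull y (take i (B :: l)).
  rewrite /v strip_id //; case: i => [|i]; first by rewrite take0 mull_nil.
  rewrite (@head_mull y _ (push B [::])) //= (negbTE B1) //.
exists 0 => //; split=> [i|i _].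
  by rewrite leqn0 => /eqP->; rewrite v0 addn0.
have nti : normal (take i (B :: l)) := normal_take i nL.
(* The endpoint arises from the [i]-th point by right multiplication with [drop i (B :: l)], which
   does not lower the number of atoms and adds at least one letter per factor. *)
rewrite !vE take_size !wlen_mull; split.
  rewrite -[X in _ <= size (mull y X)](cat_take_drop i).
  rewrite -mull_normal ?cat_take_drop // -mull_mull.
  apply: size_mull_ge; last exact: normal_drop.
  exact: normal_mull.
rewrite -addnA leq_add2l.
have -> : wlen (B :: l) = wlen (take i (B :: l)) + wlen (drop i (B :: l)).
  by rewrite -{1}(cat_take_drop i (B :: l)) /wlen map_cat sumn_cat.
by rewrite leq_add2l -size_drop size_le_wlen //; apply: normal_drop.
Qed.

Lemma strip_mull k l : strip (mull k (strip l)) = strip (mull k l).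
Proof.
elim: k => [|A k IH] /=; last by rewrite -strip_push IH strip_push.
elim: l => //= A l IH; case: eqVneq => [_|/negbTE e]; last by rewrite /= e.
by rewrite strip_cj IH.
Qed.

(** Each atom [B] of [k] is undone by [(compl B) Delta^-1], at the cost of at most one factor. This
    bounds the atomnorm of an inverse. *)
Lemma strip_mull_onto k l : free l ->
  exists2 k', free k' & size k' <= size k + size l /\ strip (mull k k') = l.
Proof.
elim: k l => [|B k IH] l fl.
  by exists l => //; split; rewrite //= strip_id //; case: fl.
have nc := normal_cj fl.1.
have [|k' fk' [sz e]] := IH (strip (push (compl B) (cjl l))).
  exact/free_strip/normal_push.
exists k' => //; split.
  apply: leq_trans sz _; rewrite addSnnS leq_add2l (leq_trans (size_strip _)) //.
  by rewrite (leq_trans (size_push _ _)) // size_map.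
rewrite /= -strip_push e strip_push -push_adds ?adds_compl //.
rewrite mul_compl push_w0 //= eqxx strip_cj cjlK.
by apply: strip_id; case: fl.
Qed.

Lemma mulword_flatten (l : seq (seq S)) k : all reduced l ->
  mulword (flatten l) k = mull (map ev l) k.
Proof.
elim: l => //= x l IH /andP[rx /IH e].
by rewrite mulword_cat mulword_reduced // e.
Qed.

Lemma act_mull g : exists n, forall l, free l ->
  act g l = strip (mull (vertex_nf g) (iter n cjl l)).
Proof.
have [n e] := act_same_vertex (same_vertex_nf g).
exists n => l fl.
have fi i : free (iter i cjl l) by elim: i => //= i; apply: free_cj.
have := e _ (fi n); rewrite act_pos // mulword_words => ->.
rewrite -iterD addnn; congr act; elim: n {e} => //= n {1}->.
by rewrite cjlK.
Qed.

Lemma geodesic_convexity (v w u p : gword S) : on_geodesic m D v w p ->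
  ~ same_vertex m D p v -> ~ same_vertex m D p w ->
  [/\ d_at m D u p <= maxn (d_at m D u v) (d_at m D u w),
      d_wd m D u p < maxn (d_wd m D u v) (d_wd m D u w) &
      d_wd m D u p + minn (d_at m D v p) (d_at m D w p)
        <= maxn (d_wd m D u v) (d_wd m D u w)].
Proof.
case=> l [sp [i il pi]] pv pw.
have [el rl] := special_nf_ev sp.
have fL := free_vertex_nf (ginv v ++ w).
set L := vertex_nf (ginv v ++ w) in el fL.
have sL : size L = size l by rewrite -el size_map.
have vw : same_vertex m D (v ++ ginv v ++ w) w.
  exact/grp_eq_same_vertex/grp_eq_mulK.
have fnil := free_nil.
have act_take : act (pos (flatten (take i l))) [::] = take i L.
  rewrite act_pos // mulword_flatten; last first.
    by apply/allP => x /mem_take /(allP rl).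
  have [nt ht] := free_take i fL.
  by rewrite map_take el mull_nil // strip_id.
have nfp (x : gword S) : vertex_nf (x ++ p) = act (x ++ v) (take i L).
  have := vertex_nf_same (same_vertex_catl x pi) => <-.
  by rewrite /vertex_nf catA !act_cat act_take.
have nfw (x : gword S) : vertex_nf (x ++ w) = act (x ++ v) (take (size L) L).
  have := vertex_nf_same (same_vertex_catl x vw) => ->.
  by rewrite take_size /vertex_nf catA act_cat.
have i_gt0 : 0 < i.
  by case: i pi {il act_take nfp} => // pi; case: pv; rewrite take0 cats0 in pi.
have i_lt : i < size L.
  rewrite sL ltn_neqAle il andbT; apply/eqP => ei; apply: pw.
  apply: same_vertex_trans pi _; apply: same_vertex_trans vw.
  apply: same_vertex_catl; rewrite ei take_size.
  have [r [gr [[lr _] _]]] := sp.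
  apply: same_vertex_trans (same_vertex_sym gr).
  exact/grp_eq_same_vertex/pos_eq_grp.
have d_vp : d_at m D v p = i.
  rewrite d_atE nfp (act_grp_eq (grp_eq_invl m v)); last exact: free_take.
  by rewrite size_takel // ltnW.
(* An upper bound suffices, as this distance enters only through a minimum on the smaller side. A
   preimage [k] of the base point under [drop i L] has at most [size L - i] factors, and conjugated
   [n] times it becomes the vertex [p] seen from [w]. *)
have d_wp : d_at m D w p <= size L - i.
  rewrite d_atE nfp.
  have -> : ginv w ++ v = ginv (ginv v ++ w) by rewrite ginv_cat ginvK.
  have [k fk [sk ek]] := strip_mull_onto (drop i L) fnil.
  have [n e] := act_same_vertex (same_vertex_nf (ginv v ++ w)).
  have fi : free (iter n cjl k) by elim: n {e} => //= n; apply: free_cj.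
  have -> : take i L = act (ginv v ++ w) (iter n cjl k).
    rewrite -e // act_pos // mulword_words -/L -(cat_take_drop i L).
    rewrite mull_cat -strip_mull ek mull_nil; last exact: normal_take fL.1.
    by rewrite cat_take_drop strip_id //; case: (free_take i fL).
  rewrite act_invK // -size_drop -[X in _ <= X]addn0.
  by apply: leq_trans sk; elim: n {e fi} => //= n; rewrite size_map.
rewrite d_vp; move: (d_at m D w p) d_wp => d_wp le_wp.
rewrite !d_wdE !d_atE.
(* Seen from [u], the geodesic runs through the products of [C] with prefixes of [L], conjugated [n]
   times by Delta; conjugation preserves sizes, prefixes and the absence of Delta. *)
have [n actE] := act_mull (ginv u ++ v).
set C := vertex_nf (ginv u ++ v) in actE *.
rewrite !nfp !nfw !actE //; try exact: free_take.
have cj_take j : iter n cjl (take j L) = take j (iter n cjl L).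
  by elim: n {actE} => //= n ->; rewrite map_take.
have fL' : free (iter n cjl L) by elim: n {actE cj_take} => //= n; apply: free_cj.
have sL' : size (iter n cjl L) = size L.
  by elim: n {actE cj_take fL'} => //= n <-; rewrite size_map.
rewrite !cj_take; have := geodesic_valley fL' (free_vertex_nf (ginv u ++ v)).
rewrite -/C sL' => -[j jL [low high]].
(* On the descending side [p] is compared with [v], with gain [i > 0]; on the ascending side with
   [w], with gain [size L - i > 0]. *)
have [ij|/ltnW ji] := leqP i j.
  have [h1 h2] := low i ij; split; rewrite leq_max.
  - by rewrite h1.
  - by rewrite (leq_trans _ h2) // -addn1 leq_add2l.
  - by rewrite (leq_trans _ h2) // leq_add2l geq_minl.
have [|h1 h2] := high i; first by rewrite ji ltnW.
split; rewrite leq_max; apply/orP; right => //.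
- by apply: leq_trans h2; rewrite -addn1 leq_add2l subn_gt0.
- by apply: leq_trans h2; rewrite leq_add2l (leq_trans (geq_minr _ _)).
Qed.
End GreedyLists.

Theorem theorem3p11 (S : finType) (m : S -> S -> nat) (D : seq S) :
  coxeter_matrix m -> coxeter_finite m -> is_Delta m D ->
  forall v w u p : gword S,
    on_geodesic m D v w p ->
    ~ same_vertex m D p v -> ~ same_vertex m D p w ->
    [/\ d_at m D u p <= maxn (d_at m D u v) (d_at m D u w),
        d_wd m D u p < maxn (d_wd m D u v) (d_wd m D u w) &
        d_wd m D u p + minn (d_at m D v p) (d_at m D w p)
          <= maxn (d_wd m D u v) (d_wd m D u w)].
Proof.
move=> Hm _ HD v w u p pvw pv pw.
(* If Delta is trivial, a generator would be longer than the longest element, so [S] is empty and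
   [p] and [v] are both the empty word, against [p] differing from [v]. *)
have [e|w0_neq1] := eqVneq (w0 Hm D) 1%g; last first.
  exact: geodesic_convexity w0_neq1 _ _ _ _ pvw pv pw.
have noS (s : S) : False by have := len_le_w0 HD (gen Hm s); rewrite e len1 len_gen.
have nil (g : gword S) : g = [::] by case: g => // -[s b] g; case: (noS s).
case: pv; rewrite (nil p) (nil v).
exact/grp_eq_same_vertex/grp_refl.
Qed.
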